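(* Let $A,B\subseteq\mathbb{R}^d$ be bounded measurable sets and let $f:[0,1]\to\mathbb{C}$ be trace class admissible for $L^2(\mathbb{R}^d)$. Then $f(S_{A,B})$ is trace class.
   Context: The Fourier transform on $L^2(\mathbb{R}^d)$ is $\mathcal{F}f(\xi)=\int_{\mathbb{R}^d}e^{-2\pi i x\cdot\xi}f(x)\,dx$. For a measurable set $A\subset\mathbb{R}^d$, $P_A$ is multiplication by the indicator $1_A$ and $Q_A=\mathcal{F}^{-1}P_A\mathcal{F}$. For measurable $A,B\subset\mathbb{R}^d$ of finite measure, $S_{A,B}=P_AQ_BP_A$ is a non-negative self-adjoint trace class operator on $L^2(\mathbb{R}^d)$; $\lambda_1(A,B)\ge\lambda_2(A,B)\ge\dots\ge0$ are its eigenvalues counted with multiplicity, all at most $1$. For a compact self-adjoint operator $T$ with eigenvalues $1\ge\lambda_1\ge\lambda_2\ge\dots\ge0$ and corresponding orthonormal eigenvectors $v_1,v_2,\dots$, and $f:[0,1]\to\mathbb{C}$ with $f(0)=0$, define $f(T)v=\sum_{n}f(\lambda_n)\langle v,v_n\rangle v_n$; it is trace class when $\operatorname{Tr}f(T)=\sum_nf(\lambda_n)$ converges absolutely. For $f:[0,1]\to\mathbb{C}$ let $M_0f(t)=\sup_{0\le x\le t}|f(x)|$. The function $f$ is trace class admissible for $L^2(\mathbb{R}^d)$ if there is $\delta\in(0,1/e)$ such that $$\int_0^\delta\frac{M_0f(\varepsilon)\,\left(\log\frac1\varepsilon\right)^{d-1}}{\varepsilon\left(\log\log\frac1\varepsilon\right)^d}\,d\varepsilon<\infty.$$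 (Such an $f$ automatically satisfies $\lim_{x\to0^+}f(x)=f(0)=0$.) *)

(* Defs.v *)
From HB Require Import structures.
From mathcomp Require Import all_boot all_order all_algebra.
From mathcomp Require Import all_classical all_reals all_analysis.
From mathcomp Require Import complex.

Set Implicit Arguments.
Unset Strict Implicit.
Unset Printing Implicit Defensive.

Import Order.TTheory GRing.Theory Num.Theory.
Import numFieldNormedType.Exports.
Import Normc.

Local Open Scope classical_set_scope.
Local Open Scope ring_scope.

(* [R^d] carries the library's product sigma-algebra on tuples, that is, its
   Borel sigma-algebra. *)
Notation Rd R d := (d.-tuple (measurableTypeR R)).

Section LebesgueMeasure.
Context {R : realType}.

Definition consRd (d : nat) (p : (measurableTypeR R * Rd R d)%type)
    : Rd R d.+1 :=
  [tuple of p.1 :: p.2].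

Definition unconsRd (d : nat) (x : Rd R d.+1)
    : (measurableTypeR R * Rd R d)%type :=
  (thead x, [tuple of behead x]).

Lemma consRdK (d : nat) : cancel (@consRd d) (@unconsRd d).
Proof.
by case=> x t; rewrite /unconsRd /consRd /= theadE; congr pair; exact: val_inj.
Qed.

Lemma measurable_consRd (d : nat) : measurable_fun [set: _] (@consRd d).
Proof. exact: (measurable_cons measurable_fst measurable_snd). Qed.

Lemma measurable_unconsRd (d : nat) : measurable_fun [set: _] (@unconsRd d).
Proof.
apply: measurable_fun_pair; last exact: measurable_behead.
exact: measurable_tnth.
Qed.

Section product_lebesgue.
Context (d : nat) (mu : {sigma_finite_measure set (Rd R d) -> \bar R}).

(* Product of [lebesgue_measure] and [mu], transported along [consRd]. *)
Definition product_lebesgue : set (Rd R d.+1) -> \bar R :=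
  pushforward (@lebesgue_measure R \x mu)%E (@consRd d).

Let pl0 : product_lebesgue set0 = 0%E.
Proof. by rewrite /product_lebesgue /pushforward preimage_set0 measure0. Qed.

Let pl_ge0 X : (0 <= product_lebesgue X)%E.
Proof. by rewrite /product_lebesgue /pushforward measure_ge0. Qed.

Let pl_sigma_additive : semi_sigma_additive product_lebesgue.
Proof.
have mpre Y : measurable Y -> measurable (@consRd d @^-1` Y).
  by move=> mY; rewrite -[X in measurable X]setTI; exact: measurable_consRd.
move=> F mF tF mUF; rewrite /product_lebesgue /pushforward preimage_bigcup.
apply: measure_semi_sigma_additive.
- by move=> n; exact: mpre.
- apply/trivIsetP => /= i j _ _ ij; rewrite -preimage_setI.
  by move/trivIsetP : tF => /(_ _ _ _ _ ij) ->//; rewrite preimage_set0.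
- by rewrite -preimage_bigcup; exact: mpre.
Qed.

HB.instance Definition _ := isMeasure.Build _ _ _
  product_lebesgue pl0 pl_ge0 pl_sigma_additive.

Let sigma_finite_product_lebesgue : sigma_finite setT product_lebesgue.
Proof.
have /sigma_finiteP[F [TF ndF Foo]] := sigma_finiteT (@lebesgue_measure R).
have /sigma_finiteP[G [TG ndG Goo]] := sigma_finiteT mu.
exists (fun n => @unconsRd d @^-1` (F n `*` G n)).
  apply/esym; rewrite -subTset => x _.
  have [n _ Fn] : (\bigcup_n F n) (unconsRd x).1 by rewrite -TF.
  have [k _ Gk] : (\bigcup_k G k) (unconsRd x).2 by rewrite -TG.
  exists (maxn n k) => //; split.
  - by move: Fn; exact/subsetPset/ndF/leq_maxl.
  - by move: Gk; exact/subsetPset/ndG/leq_maxr.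
move=> n; have [mF ltF] := Foo n; have [mG ltG] := Goo n; split.
  by rewrite -[X in measurable X]setTI; apply: measurable_unconsRd => //;
    exact: measurableX.
rewrite /product_lebesgue /pushforward -comp_preimage.
rewrite (_ : _ \o _ = id); last by apply/funext => p; exact: consRdK.
by rewrite preimage_id product_measure1E// lte_mul_pinfty// ge0_fin_numE.
Qed.

HB.instance Definition _ := @Measure_isSigmaFinite.Build _ _ _
  product_lebesgue sigma_finite_product_lebesgue.

End product_lebesgue.

Section dirac0.

Definition lebesgueR0 : set (Rd R 0) -> \bar R := \d_([tuple] : Rd R 0).

HB.instance Definition _ := Measure.on lebesgueR0.

Let sigma_finite_lebesgueR0 : sigma_finite setT lebesgueR0.
Proof. exact: sigma_finiteT. Qed.

HB.instance Definition _ := @Measure_isSigmaFinite.Build _ _ _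
  lebesgueR0 sigma_finite_lebesgueR0.

End dirac0.

(* The [d]-fold product of [lebesgue_measure], identifying [R^(d+1)] with
   [R * R^d]. *)
Fixpoint lebesgue_measureRd (d : nat)
    : {sigma_finite_measure set (Rd R d) -> \bar R} :=
  match d with
  | 0 => lebesgueR0
  | d'.+1 => product_lebesgue (lebesgue_measureRd d')
  end.

End LebesgueMeasure.

Section SquareIntegrable.
Context {R : realType} {d : nat}.
Local Notation leb := (@lebesgue_measureRd R d).
Local Notation C := R[i].

(* [A] is Lebesgue measurable: it is a Borel set up to a null set. *)
Definition lebesgue_measurableRd (A : set (Rd R d)) :=
  exists2 A0 : set (Rd R d), measurable A0 &
    leb.-negligible ((A `\` A0) `|` (A0 `\` A)).

Definition boundedRd (A : set (Rd R d)) :=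
  exists r : R, forall x, A x -> forall i, `|tnth x i : R| <= r.

Definition cmeasurable (g : Rd R d -> C) :=
  measurable_fun setT (fun x => complex.Re (g x) : R) /\
  measurable_fun setT (fun x => complex.Im (g x) : R).

Definition cintegral (g : Rd R d -> C) : C :=
  Complex (\int[leb]_x complex.Re (g x)) (\int[leb]_x complex.Im (g x)).

(* The square of the L^2 norm, possibly infinite. *)
Definition sqnorm (g : Rd R d -> C) : \bar R :=
  (\int[leb]_x (normc (g x) ^+ 2)%:E)%E.

(* Elements of L^2(R^d) are represented by Borel functions, which every class
   of square integrable functions contains; equality in L^2 is [ae_eq]. *)
Definition inL2 (g : Rd R d -> C) := cmeasurable g /\ (sqnorm g < +oo)%E.

Definition inner (g h : Rd R d -> C) : C :=
  cintegral (fun x => g x * (h x)^*%C).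

End SquareIntegrable.

Section TimeFrequency.
Context {R : realType} {d : nat}.
Local Notation leb := (@lebesgue_measureRd R d).
Local Notation C := R[i].

Definition dotRd (x y : Rd R d) : R :=
  \sum_(i < d) (tnth x i : R) * (tnth y i : R).

Definition expi (t : R) : C := Complex (cos t) (sin t).

(* The integral of [exp (s * 2 i pi x.xi) * g x] over [x], with [s = -1] for
   the Fourier transform and [s = 1] for its inverse. *)
Definition fourier_integral (s : R) (g : Rd R d -> C) (xi : Rd R d) : C :=
  cintegral (fun x => expi (s * 2 * pi * dotRd x xi) * g x).

Definition PP (A : set (Rd R d)) (g : Rd R d -> C) (x : Rd R d) : C :=
  ((\1_A x : R)%:C)%C * g x.

Definition cube (N : nat) : set (Rd R d) :=
  [set x | forall i, `|tnth x i : R| <= N%:R].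

(* A function of L^2 need not be integrable: its Fourier transform is the limit
   in L^2 of the Fourier integrals of its truncations, which exists by
   Plancherel's theorem and is unique up to a null set. *)
Definition fourier_limit (s : R) (g h : Rd R d -> C) :=
  cmeasurable h /\
  sqnorm (fun xi => h xi - fourier_integral s (PP (cube N) g) xi)
    @[N --> \oo] --> 0%E.

Definition fourier (g : Rd R d -> C) : Rd R d -> C :=
  xget (fun=> 0) [set h | fourier_limit (-1) g h].

Definition inv_fourier (g : Rd R d -> C) : Rd R d -> C :=
  xget (fun=> 0) [set h | fourier_limit 1 g h].

Definition QQ (A : set (Rd R d)) (g : Rd R d -> C) : Rd R d -> C :=
  inv_fourier (PP A (fourier g)).

Definition SS (A B : set (Rd R d)) (g : Rd R d -> C) : Rd R d -> C :=
  PP A (QQ B (PP A g)).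

End TimeFrequency.

Section FunctionalCalculus.
Context {R : realType} {d : nat}.
Local Notation leb := (@lebesgue_measureRd R d).
Local Notation C := R[i].
Variable T : (Rd R d -> C) -> (Rd R d -> C).

Definition eigenvector (mu : R) (v : Rd R d -> C) :=
  inL2 v /\ ae_eq leb setT (T v) (fun x => (mu%:C)%C * v x).

Definition orthonormal (n : nat) (v : 'I_n -> Rd R d -> C) :=
  forall i j, inner (v i) (v j) = (i == j)%:R.

(* The eigenvalues of a compact non-negative self-adjoint operator, counted
   with multiplicity and padded with zeros: [eigenvalue k] is the [k+1]-st
   largest one, i.e. the largest [t] such that there are [k+1] orthonormal
   eigenvectors whose eigenvalues are at least [t]. *)
Definition eigenvalue (k : nat) : R :=
  sup [set t | t = 0 \/
    exists (mu : 'I_k.+1 -> R) (v : 'I_k.+1 -> Rd R d -> C),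
      [/\ forall i, eigenvector (mu i) (v i), orthonormal v &
          forall i, t <= mu i]].

(* [f(T)] is trace class: its trace, the sum of [f] over the eigenvalues of
   [T], converges absolutely. *)
Definition trace_class_fun (f : R -> C) :=
  (\sum_(k <oo) (normc (f (eigenvalue k)))%:E < +oo)%E.

End FunctionalCalculus.

Section Admissible.
Context {R : realType}.

Definition M0 (f : R -> R[i]) (t : R) : \bar R :=
  ereal_sup [set (normc (f x))%:E | x in `[0, t]].

(* Only the values of [f] on [0, 1] matter. *)
Definition trace_class_admissible (d : nat) (f : R -> R[i]) :=
  exists delta : R, [/\ 0 < delta, delta < expR (-1) &
    (\int[lebesgue_measure]_(e in `]0%R, delta[)
       (M0 f e *
        ((ln (e^-1)) ^+ d.-1 / (e * (ln (ln (e^-1))) ^+ d))%R%:E) < +oo)%E].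

End Admissible.

(* Main.v *)
(** Since [A] and [B] are bounded, the truncated Fourier integrals are
    eventually constant, so almost everywhere [S v] is the double integral over
    [A] and [B] of [exp (2 i pi (x - y).xi) v y].  Replacing [exp (2 i pi x.xi)]
    by its Taylor polynomial of degree less than [M] gives an operator of rank at
    most [M ^ d] with error [C a ^ M / M!].  Among [n > M ^ d] orthonormal
    eigenvectors some unit combination is killed by the finite rank part, so the
    [k]-th eigenvalue is at most [C a ^ M / M!] as soon as [M ^ d <= k].
    With [M = 2 ^ (i + 2)] this is at most [eps_i := 2 ^ - (i 2 ^ i)] for large
    [i], while the part of the admissibility integral between [eps_(i+1)] and
    [eps_i] is at least a constant times [2 ^ (i d) M0 f eps_(i+1)]; summing over
    these blocks of eigenvalues gives the result. *)
Require Import Defs.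
From HB Require Import structures.
From mathcomp Require Import all_boot all_order all_algebra.
From mathcomp Require Import all_classical all_reals all_analysis.
From mathcomp Require Import complex measurable_realfun zify ring lra.

Set Implicit Arguments.
Unset Strict Implicit.
Unset Printing Implicit Defensive.

Import Order.TTheory GRing.Theory Num.Theory.
Import numFieldNormedType.Exports.
Import Normc.

Local Open Scope classical_set_scope.
Local Open Scope ring_scope.

(** * Integration of complex functions *)

Section AlmostEverywhere.
Context d (T : measurableType d) (R : realType).
Variable mu : {measure set T -> \bar R}.
Import HBNNSimple.

(** The integral of a nonnegative function is the supremum of the integrals of the simple functions
    below it. A simple [h] below [f], set to zero on the exceptional null set, lies below [g] and
    keeps its integral. *)
Let ge0_ae_integral_le (f g : T -> \bar R) : (forall x, 0 <= f x)%E ->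
  (forall x, 0 <= g x)%E -> ae_eq mu setT f g ->
  (\int[mu]_x f x <= \int[mu]_x g x)%E.
Proof.
move=> f0 g0 [N [mN N0 fgN]].
rewrite (ge0_integralTE mu f0); apply: ge_ereal_sup => _ [h /= hf <-].
have mNC : measurable (~` N) by exact: measurableC.
have [hN hNE] : exists hN : {nnsfun T >-> R},
    forall x, hN x = h x * \1_(~` N) x.
  by exists (proj_nnsfun h mNC) => x.
have -> : sintegral mu h = sintegral mu hN.
  rewrite -!integralT_nnsfun; apply: ge0_ae_eq_integral => //.
  - by apply/measurable_EFinP.
  - by apply/measurable_EFinP.
  - by move=> x _; rewrite lee_fin.
  - by move=> x _; rewrite lee_fin.
  - exists N; split=> // x /=; apply: contra_notP => Nx _; rewrite hNE.
    by rewrite indicE mem_set// mulr1.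
rewrite (ge0_integralTE mu g0); apply: ereal_sup_ubound; exists hN => //= x.
rewrite hNE indicE; have [|] := boolP (x \in ~` N); last by rewrite mulr0.
rewrite inE /= mulr1 => Nx; apply: le_trans (hf x) _.
suff -> : f x = g x by [].
by apply: contrapT => fg; apply: Nx; apply: fgN => /= H; apply: fg; exact: H.
Qed.

(* Unlike in [ae_eq_integral], measurability is not required: [PP A g] need not be
   Borel when [A] is only Lebesgue measurable. *)
Lemma ae_eq_integralT (f g : T -> \bar R) : ae_eq mu setT f g ->
  (\int[mu]_x f x = \int[mu]_x g x)%E.
Proof.
move=> fg.
have H (u v : T -> \bar R) : (forall x, 0 <= u x)%E -> (forall x, 0 <= v x)%E ->
    ae_eq mu setT u v -> (\int[mu]_x u x = \int[mu]_x v x)%E.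
  move=> u0 v0 uv; apply/eqP; rewrite eq_le !ge0_ae_integral_le//.
  exact: ae_eq_sym.
rewrite integralE [RHS]integralE; congr (_ - _)%E; apply: H => //.
- by apply: filterS fg => x /= fg /fg E; rewrite !funeposE E.
- by apply: filterS fg => x /= fg /fg E; rewrite !funenegE E.
Qed.

Lemma ae_eq_RintegralT (f g : T -> R) : ae_eq mu setT f g ->
  \int[mu]_x f x = \int[mu]_x g x.
Proof.
move=> fg; rewrite /Rintegral; congr fine; apply: ae_eq_integralT.
by apply: filterS fg => x /= fg /fg ->.
Qed.

End AlmostEverywhere.

(** * Modulus, real part and imaginary part *)

Section ComplexModulus.
Context {R : realType}.
Implicit Types x y : R[i].

Lemma Re_add x y : complex.Re (x + y) = complex.Re x + complex.Re y.
Proof. by case: x; case: y. Qed.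

Lemma Im_add x y : complex.Im (x + y) = complex.Im x + complex.Im y.
Proof. by case: x; case: y. Qed.

Lemma Re_mul x y : complex.Re (x * y) =
  complex.Re x * complex.Re y - complex.Im x * complex.Im y.
Proof. by case: x; case: y. Qed.

Lemma Im_mul x y : complex.Im (x * y) =
  complex.Re x * complex.Im y + complex.Im x * complex.Re y.
Proof. by case: x; case: y. Qed.

Lemma normc_sqr x : normc x ^+ 2 = complex.Re x ^+ 2 + complex.Im x ^+ 2.
Proof. by case: x => a b /=; rewrite sqr_sqrtr// addr_ge0// sqr_ge0. Qed.

Lemma normc_ge0 x : 0 <= normc x.
Proof. by case: x => a b; exact: sqrtr_ge0. Qed.

Lemma normr_Re_le x : `|complex.Re x| <= normc x.
Proof.
rewrite -(@ler_pXn2r _ 2)// ?nnegrE ?normc_ge0// real_normK ?num_real//.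
by rewrite normc_sqr lerDl sqr_ge0.
Qed.

Lemma normr_Im_le x : `|complex.Im x| <= normc x.
Proof.
rewrite -(@ler_pXn2r _ 2)// ?nnegrE ?normc_ge0// real_normK ?num_real//.
by rewrite normc_sqr lerDr sqr_ge0.
Qed.

Lemma normc_le_ReIm x : normc x <= `|complex.Re x| + `|complex.Im x|.
Proof.
rewrite -(@ler_pXn2r _ 2)// ?nnegrE ?normc_ge0// ?addr_ge0//.
rewrite normc_sqr sqrrD !real_normK ?num_real// -addrA lerD2l.
by rewrite lerDr mulrn_wge0// mulr_ge0.
Qed.

Lemma normc_conj x : normc x^*%C = normc x.
Proof. by case: x => a b /=; rewrite sqrrN. Qed.

Lemma normc_real (a : R) : normc a%:C%C = `|a|.
Proof. by rewrite /= expr0n addr0 sqrtr_sqr. Qed.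

Lemma normc_sqr_conj x : ((normc x ^+ 2)%:C)%C = x * x^*%C.
Proof.
by rewrite normc_sqr; case: x => a b /=; apply/eqP; rewrite eq_complex /=;
   apply/andP; split; apply/eqP; ring.
Qed.

End ComplexModulus.

(** * Measurability and integrability by real and imaginary parts *)

Section ComplexIntegral.
Context {R : realType} {d : nat}.
Local Notation leb := (@lebesgue_measureRd R d).
Local Notation C := R[i].
Implicit Types (g h : Rd R d -> C) (F : Rd R d -> R).

Lemma cmeasurable_cst (c : C) : @cmeasurable R d (fun=> c).
Proof. by split; exact: measurable_cst. Qed.

Lemma cmeasurableD g h : cmeasurable g -> cmeasurable h ->
  cmeasurable (fun x => g x + h x).
Proof.
move=> [g1 g2] [h1 h2]; split.
- by under eq_fun do rewrite Re_add; exact: measurable_funD.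
- by under eq_fun do rewrite Im_add; exact: measurable_funD.
Qed.

Lemma cmeasurableM g h : cmeasurable g -> cmeasurable h ->
  cmeasurable (fun x => g x * h x).
Proof.
move=> [g1 g2] [h1 h2]; split.
- by under eq_fun do rewrite Re_mul; apply: measurable_funB;
    exact: measurable_funM.
- by under eq_fun do rewrite Im_mul; apply: measurable_funD;
    exact: measurable_funM.
Qed.

Lemma cmeasurable_sum (I : Type) (s : seq I) (g : I -> Rd R d -> C) :
  (forall i, cmeasurable (g i)) -> cmeasurable (fun x => \sum_(i <- s) g i x).
Proof.
move=> mg; elim: s => [|i s IH].
  by under eq_fun do rewrite big_nil; exact: cmeasurable_cst.
by under eq_fun do rewrite big_cons; exact: cmeasurableD.
Qed.

Lemma cmeasurable_real F : measurable_fun setT F ->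
  cmeasurable (fun x => (F x)%:C%C).
Proof. by move=> mF; split=> //=; exact: measurable_cst. Qed.

Lemma cmeasurable_conj g : cmeasurable g -> cmeasurable (fun x => (g x)^*%C).
Proof.
move=> [g1 g2]; split.
- by rewrite (_ : (fun x => _) = fun x => complex.Re (g x))//;
    apply/funext => x; case: (g x).
- rewrite (_ : (fun x => _) = fun x => - complex.Im (g x)).
    exact: measurable_funN.
  by apply/funext => x; case: (g x).
Qed.

Lemma measurable_normc_sqr g : cmeasurable g ->
  measurable_fun setT (fun x => normc (g x) ^+ 2).
Proof.
move=> [g1 g2]; under eq_fun do rewrite normc_sqr.
by apply: measurable_funD; exact: measurable_funX.
Qed.

Lemma cmeasurable_PP (A : set (Rd R d)) g : measurable A -> cmeasurable g ->
  cmeasurable (PP A g).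
Proof.
move=> mA mg; apply: cmeasurableM => //; apply: cmeasurable_real.
exact: measurable_indic.
Qed.

Definition cintegrable g :=
  leb.-integrable setT (fun x => (complex.Re (g x))%:E) /\
  leb.-integrable setT (fun x => (complex.Im (g x))%:E).

Lemma cintegrable_le g F : cmeasurable g ->
  leb.-integrable setT (EFin \o F) -> (forall x, normc (g x) <= F x) ->
  cintegrable g.
Proof.
move=> [g1 g2] iF gF; split; apply: le_integrable iF => //.
- exact/measurable_EFinP.
- move=> x _; rewrite lee_fin (le_trans (normr_Re_le _))//.
  by rewrite (le_trans (gF x))// ler_norm.
- exact/measurable_EFinP.
- move=> x _; rewrite lee_fin (le_trans (normr_Im_le _))//.
  by rewrite (le_trans (gF x))// ler_norm.
Qed.

Lemma cintegrableD g h : cintegrable g -> cintegrable h ->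
  cintegrable (fun x => g x + h x).
Proof.
move=> [g1 g2] [h1 h2]; split.
- by under eq_fun do rewrite Re_add EFinD; exact: integrableD.
- by under eq_fun do rewrite Im_add EFinD; exact: integrableD.
Qed.

Lemma cintegralD g h : cintegrable g -> cintegrable h ->
  cintegral (fun x => g x + h x) = cintegral g + cintegral h.
Proof.
move=> [g1 g2] [h1 h2]; rewrite /cintegral.
under eq_Rintegral do rewrite Re_add.
rewrite RintegralD//.
under [in X in Complex _ X = _]eq_Rintegral do rewrite Im_add.
by rewrite RintegralD.
Qed.

Lemma cintegrableZ (c : C) g : cintegrable g -> cintegrable (fun x => c * g x).
Proof.
move=> [g1 g2]; split.
- under eq_fun do rewrite Re_mul EFinB !EFinM.
  by apply: integrableB => //; exact: integrableZl.
- under eq_fun do rewrite Im_mul EFinD !EFinM.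
  by apply: integrableD => //; exact: integrableZl.
Qed.

Lemma cintegralZ (c : C) g : cintegrable g ->
  cintegral (fun x => c * g x) = c * cintegral g.
Proof.
move=> [g1 g2]; rewrite /cintegral.
have iZ (a : R) (G : Rd R d -> R) : leb.-integrable setT (EFin \o G) ->
    leb.-integrable setT (EFin \o (fun x => a * G x)).
  by move=> iG; exact: (integrableZl measurableT a iG).
under eq_Rintegral do rewrite Re_mul.
rewrite RintegralB//; [|exact: iZ|exact: iZ].
under [in X in Complex _ X = _]eq_Rintegral do rewrite Im_mul.
rewrite RintegralD//; [|exact: iZ|exact: iZ].
by rewrite !RintegralZl//; case: c.
Qed.

Lemma cintegrable_sum (I : Type) (s : seq I) (g : I -> Rd R d -> C) :
  (forall i, cintegrable (g i)) -> cintegrable (fun x => \sum_(i <- s) g i x).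
Proof.
move=> ig; elim: s => [|i s IH].
  by under eq_fun do rewrite big_nil; split; exact: integrable0.
by under eq_fun do rewrite big_cons; exact: cintegrableD.
Qed.

Lemma cintegral_sum (I : Type) (s : seq I) (g : I -> Rd R d -> C) :
  (forall i, cintegrable (g i)) ->
  cintegral (fun x => \sum_(i <- s) g i x) = \sum_(i <- s) cintegral (g i).
Proof.
move=> ig; elim: s => [|i s IH].
  rewrite big_nil /cintegral.
  under eq_Rintegral do rewrite big_nil /=.
  under [in X in Complex _ X = _]eq_Rintegral do rewrite big_nil /=.
  by rewrite /Rintegral integral0.
rewrite big_cons -IH -cintegralD//; last exact: cintegrable_sum.
by congr cintegral; apply/funext => x; rewrite big_cons.
Qed.

Lemma ae_eq_cintegral g h : ae_eq leb setT g h -> cintegral g = cintegral h.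
Proof.
move=> gh; rewrite /cintegral; congr Complex; apply: ae_eq_RintegralT.
- by apply: filterS gh => x /= gh /gh ->.
- by apply: filterS gh => x /= gh /gh ->.
Qed.

(** Real and imaginary parts are estimated separately, whence the factor 2. The loss only affects
    constants in the eigenvalue bound. *)
Lemma normc_cintegral_le g F : cmeasurable g ->
  leb.-integrable setT (EFin \o F) -> (forall x, normc (g x) <= F x) ->
  normc (cintegral g) <= 2 * \int[leb]_x F x.
Proof.
move=> mg iF gF; have [i1 i2] := cintegrable_le mg iF gF.
apply: le_trans (normc_le_ReIm _) _; rewrite mulr_natl mulr2n /cintegral /=.
apply: lerD; apply: le_trans (le_normr_Rintegral _ _) _ => //.
- apply: le_Rintegral => //; first exact: integrable_norm.
  by move=> x _; exact: le_trans (normr_Re_le _) (gF x).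
- apply: le_Rintegral => //; first exact: integrable_norm.
  by move=> x _; exact: le_trans (normr_Im_le _) (gF x).
Qed.

End ComplexIntegral.

(** * The operator as a double integral *)

Section Cube.
Context {R : realType}.

Lemma measurable_cube d N : measurable (@cube R d N).
Proof.
rewrite (_ : cube N = \bigcap_(i in [set: 'I_d])
    ((fun x : Rd R d => tnth x i) @^-1` [set t : R | `|t| <= N%:R]));
  last first.
  by apply/seteqP; split => x /= h i; [move=> _; exact: h|exact: (h i I)].
apply: fin_bigcap_measurable => // i _.
rewrite -[X in measurable X]setTI; apply: measurable_tnth => //.
rewrite (_ : [set t : R | _] = `[- N%:R, N%:R]%classic)//.
by apply/seteqP; split => t /=; rewrite in_itv /= ler_norml.
Qed.

(** Induction on the dimension: along [consRd] a cube pulls back to the product of an interval and a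
    cube of one dimension less. *)
Lemma lebesgue_measureRd_cube d N :
  (@lebesgue_measureRd R d (cube N) < +oo)%E.
Proof.
elim: d => [|d IH] /=; first by rewrite /lebesgueR0 diracE ltry.
rewrite /product_lebesgue /pushforward.
rewrite (_ : _ @^-1` _ = `[- N%:R, N%:R]%classic `*` cube N); last first.
  apply/seteqP; split => -[t x] /=.
    move=> h; split.
      by have := h ord0; rewrite /consRd tnth0 in_itv /= ler_norml.
    move=> i; have := h (lift ord0 i).
    by rewrite /consRd tnthS.
  rewrite in_itv /= -ler_norml => -[h0 h] i.
  have [->|[j ->]] : i = ord0 \/ exists j, i = lift ord0 j.
    by case: (unliftP ord0 i) => [j ->|->]; [right; exists j|left].
  - by rewrite /consRd tnth0.
  - by rewrite /consRd tnthS.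
rewrite product_measure1E//; last exact: measurable_cube.
rewrite lte_mul_pinfty// ?measure_ge0//.
suff : lebesgue_measure `[- N%:R : R, N%:R]%classic \is a fin_num by [].
by rewrite lebesgue_measure_itv /=; case: ifP.
Qed.

Lemma boundedRdP d (A : set (Rd R d)) : boundedRd A ->
  exists N, A `<=` cube N.
Proof.
move=> [r Ar]; exists (Num.bound `|r|) => x Ax i.
rewrite (le_trans (Ar x Ax i))// (le_trans (ler_norm r))// ltW//.
exact: archi_boundP.
Qed.

(** The Borel version is cut down to a cube containing [A]; this can only shrink the symmetric
    difference. *)
Lemma bounded_borel_version d (A : set (Rd R d)) :
  lebesgue_measurableRd A -> boundedRd A ->
  exists (N : nat) (A0 : set (Rd R d)), [/\ measurable A0, A `<=` cube N,
    A0 `<=` cube N & (@lebesgue_measureRd R d).-negligible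
      ((A `\` A0) `|` (A0 `\` A))].
Proof.
move=> [A0 mA0 nA] /boundedRdP[N AN]; exists N, (A0 `&` cube N); split => //.
- by apply: measurableI => //; exact: measurable_cube.
- apply: negligibleS nA => x [[Ax nAx]|[[Ax cx] nAx]].
    left; split => // A0x; apply: nAx; split => //; exact: AN.
  by right.
Qed.

End Cube.

(** * Measurable dependence of integrals on a parameter *)

Section ParameterIntegral.
Context d1 d2 (T1 : measurableType d1) (T2 : measurableType d2) (R : realType).
Variable m2 : {sigma_finite_measure set T2 -> \bar R}.

(** Tonelli's theorem is applied to the positive and negative parts. Since [fine] and extended
    subtraction are measurable, no integrability is assumed. *)
Lemma measurable_fun_parameter_Rintegral (f : T1 * T2 -> R) :
  measurable_fun setT f -> measurable_fun setT (fun x => \int[m2]_y f (x, y)).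
Proof.
move=> mf; apply: (measurableT_comp (fine_measurable measurableT)).
have mEf : measurable_fun setT (EFin \o f) by exact/measurable_EFinP.
rewrite (_ : (fun x => _) = fun x => (fubini_F m2 (EFin \o f)^\+ x -
    fubini_F m2 (EFin \o f)^\- x)%E); last first.
  by apply/funext => x; rewrite integralE; congr (_ - _)%E;
    apply: eq_integral => y _; rewrite ?funeposE ?funenegE.
by apply: emeasurable_funB; apply: measurable_fun_fubini_tonelli_F => //;
  [exact: measurable_funepos|exact: measurable_funeneg].
Qed.

End ParameterIntegral.

(** * Fourier transforms of functions supported in a cube *)

Section Fourier.
Context {R : realType} {d : nat}.
Local Notation leb := (@lebesgue_measureRd R d).
Local Notation C := R[i].
Implicit Types (g h : Rd R d -> C) (A B : set (Rd R d)) (s : R).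

Lemma normc_expi (t : R) : normc (expi t) = 1.
Proof. by rewrite /expi /= cos2Dsin2 sqrtr1. Qed.

Lemma measurable_dotRd : measurable_fun setT
  (fun p : Rd R d * Rd R d => dotRd p.2 p.1).
Proof.
apply: measurable_sum => i; apply: measurable_funM.
- exact: (measurableT_comp (measurable_tnth i) measurable_snd).
- exact: (measurableT_comp (measurable_tnth i) measurable_fst).
Qed.

Lemma measurable_dotRdl (x : Rd R d) : measurable_fun setT (dotRd x).
Proof.
apply: measurable_sum => i; apply: measurable_funM => //.
exact: measurable_tnth.
Qed.

Lemma measurable_dotRdr (xi : Rd R d) : measurable_fun setT (dotRd^~ xi).
Proof.
apply: measurable_sum => i; apply: measurable_funM => //.
exact: measurable_tnth.
Qed.

Lemma cmeasurable_expi (F : Rd R d -> R) : measurable_fun setT F ->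
  cmeasurable (fun x => expi (F x)).
Proof.
move=> mF; split => /=; apply: measurableT_comp => //;
  apply: continuous_measurable_fun; [exact: continuous_cos|exact: continuous_sin].
Qed.

Lemma cmeasurable_fourier_integral s g : cmeasurable g ->
  cmeasurable (fourier_integral s g).
Proof.
move=> [g1 g2].
have mdot : measurable_fun setT
    (fun p : Rd R d * Rd R d => s * 2 * pi * dotRd p.2 p.1).
  by apply: measurable_funM => //; exact: measurable_dotRd.
have mcos : measurable_fun setT
    (fun p : Rd R d * Rd R d => cos (s * 2 * pi * dotRd p.2 p.1)).
  by apply: measurableT_comp => //; apply: continuous_measurable_fun;
    exact: continuous_cos.
have msin : measurable_fun setT
    (fun p : Rd R d * Rd R d => sin (s * 2 * pi * dotRd p.2 p.1)).
  by apply: measurableT_comp => //; apply: continuous_measurable_fun;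
    exact: continuous_sin.
split => /=.
- apply: (@measurable_fun_parameter_Rintegral _ _ _ _ _ leb
    (fun p => complex.Re (expi (s * 2 * pi * dotRd p.2 p.1) * g p.2))).
  under eq_fun do rewrite Re_mul.
  apply: measurable_funB; apply: measurable_funM => //.
  + exact: (measurableT_comp g1 measurable_snd).
  + exact: (measurableT_comp g2 measurable_snd).
- apply: (@measurable_fun_parameter_Rintegral _ _ _ _ _ leb
    (fun p => complex.Im (expi (s * 2 * pi * dotRd p.2 p.1) * g p.2))).
  under eq_fun do rewrite Im_mul.
  apply: measurable_funD; apply: measurable_funM => //.
  + exact: (measurableT_comp g2 measurable_snd).
  + exact: (measurableT_comp g1 measurable_snd).
Qed.

Lemma ae_eq_fourier_integral s g h : ae_eq leb setT g h ->
  fourier_integral s g = fourier_integral s h.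
Proof.
move=> gh; apply/funext => xi; apply: ae_eq_cintegral.
by apply: filterS gh => x /= gh /gh ->.
Qed.

Lemma sqnorm_eq0 g : cmeasurable g -> sqnorm g = 0%E -> ae_eq leb setT g (cst 0).
Proof.
move=> mg g0.
have : ae_eq leb setT (fun x => (normc (g x) ^+ 2)%:E) (cst 0%E).
  apply/ae_eq_integral_abs => //.
    by apply/measurable_EFinP; exact: measurable_normc_sqr.
  rewrite -[RHS]g0; apply: eq_integral => x _.
  by rewrite gee0_abs// lee_fin sqr_ge0.
apply: filterS => x /= H /H [] /eqP; rewrite sqrf_eq0 => /eqP.
exact: eq0_normc.
Qed.

(* For [g] vanishing outside a cube the truncations are eventually constant,
   so that the limit exists without appealing to Plancherel's theorem. *)
Lemma xget_fourier_limit s g g0 N : cmeasurable g0 -> ae_eq leb setT g g0 ->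
  (forall x, ~ cube N x -> g x = 0) ->
  cmeasurable (xget (fun=> 0) [set h | fourier_limit s g h]) /\
  ae_eq leb setT (xget (fun=> 0) [set h | fourier_limit s g h])
    (fourier_integral s g0).
Proof.
move=> mg0 gg0 gN; set k := fourier_integral s g0.
have mk : cmeasurable k by exact: cmeasurable_fourier_integral.
have kE n : (N <= n)%N -> fourier_integral s (PP (cube n) g) = k.
  move=> Nn; rewrite /k -(ae_eq_fourier_integral s gg0); congr fourier_integral.
  apply/funext => x; rewrite /PP indicE; case: (boolP (x \in cube n)).
    by move=> _; rewrite mul1r.
  rewrite notin_setE => nx; rewrite gN ?mulr0// => cx; apply: nx => i.
  by rewrite (le_trans (cx i))// ler_nat.
(* From index [N] on the truncations have the same Fourier integral [k], so for every [h] the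
   sequence ends up constant. *)
have lim h : sqnorm (fun xi => h xi - fourier_integral s (PP (cube n) g) xi)
    @[n --> \oo] --> sqnorm (fun xi => h xi - k xi).
  apply: cvg_near_cst; near=> n; rewrite kE; first reflexivity.
  by near: n; exists N.
(* The witness [k] shows that the set of limits is nonempty, so [xget] returns a genuine limit and
   not its default value. *)
have /(xgetPex (fun=> 0)) : exists h, [set h | fourier_limit s g h] h.
  exists k; split => //.
  rewrite [X in _ --> X](_ : _ = sqnorm (fun xi => k xi - k xi)).
    exact: lim.
  rewrite /sqnorm; under eq_integral do rewrite subrr normc0 expr0n /=.
  by rewrite integral0.
set h := xget _ _ => -[mh h0]; split => //.
(* Uniqueness of limits: the sequence for the chosen [h] tends both to its squared distance from [k]
   and to 0. *)
have /sqnorm_eq0 : sqnorm (fun xi => h xi - k xi) = 0%E.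
  rewrite -(cvg_lim (@ereal_hausdorff R) (lim h)).
  exact: (cvg_lim (@ereal_hausdorff R) h0).
have mhk : cmeasurable (fun xi => h xi - k xi).
  rewrite (_ : (fun xi => _) = fun xi => h xi + (-1) * k xi); last first.
    by apply/funext => xi; rewrite mulN1r.
  by apply: cmeasurableD => //; apply: cmeasurableM => //; exact: cmeasurable_cst.
by move=> /(_ mhk); apply: filterS => x /= H /H /subr0_eq.
Unshelve. all: by end_near. Qed.

Lemma ae_eq_PP A A0 g h : leb.-negligible ((A `\` A0) `|` (A0 `\` A)) ->
  ae_eq leb setT g h -> ae_eq leb setT (PP A g) (PP A0 h).
Proof.
move=> nA; rewrite /ae_eq => gh.
have : {ae leb, forall x, ~ ((A `\` A0) `|` (A0 `\` A)) x}.
  by move: nA; apply: negligibleS => x /=; rewrite notK.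
apply: filterS2 gh => x /= gh nx _; rewrite /PP gh// !indicE.
suff -> : (x \in A) = (x \in A0) by [].
apply/idP/idP; rewrite !inE => Ax; apply: contrapT => nAx; apply: nx.
- by left.
- by right.
Qed.

(** An explicit model of [SS]: Fourier integrals replace the limits in L^2, so values make sense at
    each point and not only up to a null set. *)
Definition SS_borel A B g : Rd R d -> C :=
  PP A (fourier_integral 1 (PP B (fourier_integral (-1) (PP A g)))).

(** [xget_fourier_limit] is used twice: for the transform of [PP A g], supported in [cube NA], then
    for the inverse transform of a function supported in [cube NB]. *)
Lemma SS_ae A B A0 B0 NA NB g :
  measurable A0 -> measurable B0 -> A `<=` cube NA -> B `<=` cube NB ->
  leb.-negligible ((A `\` A0) `|` (A0 `\` A)) ->
  leb.-negligible ((B `\` B0) `|` (B0 `\` B)) ->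
  cmeasurable g -> ae_eq leb setT (SS A B g) (SS_borel A0 B0 g).
Proof.
move=> mA0 mB0 ANA BNB nA nB mg; apply: ae_eq_PP => //.
have PP0 (D : set (Rd R d)) M (u : Rd R d -> C) : D `<=` cube M ->
    forall x, ~ cube M x -> PP D u x = 0.
  by move=> DM x nx; rewrite /PP indicE memNset ?mul0r// => /DM.
have [mF FE] : cmeasurable (fourier (PP A g)) /\
    ae_eq leb setT (fourier (PP A g)) (fourier_integral (-1) (PP A0 g)).
  apply: (@xget_fourier_limit _ _ _ NA); last exact: PP0.
  - exact: cmeasurable_PP.
  - by apply: ae_eq_PP => //; exact: ae_eq_refl.
have [_ ] : cmeasurable (QQ B (PP A g)) /\ ae_eq leb setT (QQ B (PP A g))
    (fourier_integral 1 (PP B0 (fourier_integral (-1) (PP A0 g)))).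
  apply: (@xget_fourier_limit _ _ _ NB); last exact: PP0.
  - by apply: cmeasurable_PP => //; apply: cmeasurable_fourier_integral;
      exact: cmeasurable_PP.
  - exact: ae_eq_PP.
by [].
Qed.

End Fourier.

(** * Superexponential decay of the eigenvalues *)

Section Taylor.
Context {R : realType}.

(** Since binomial coefficients are at least 1, [(k + M)!] is at least [k! M!]. The tail of the
    series from index [M] is therefore at most [a ^ M / M!] times the exponential series itself. *)
Lemma series_exp_tail (u : R^nat) (a : R) (M : nat) : 0 <= a ->
  cvgn (series u) -> (forall k, `|u k| <= exp_coeff a k) ->
  `|limn (series u) - series u M| <= a ^+ M / M`!%:R * expR a.
Proof.
move=> a0 cu ua.
have cv : `|series u n - series u M| @[n --> \oo] -->
    `|limn (series u) - series u M|.
  by apply: cvg_norm; apply: cvgB => //; exact: cvg_cst.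
apply: (cvgr_to_le cv); near=> n.
have Mn : (M <= n)%N by near: n; exists M.
rewrite sub_series_geq//.
have -> : expR a = limn (series (exp_coeff a)) by [].
apply: (@le_trans _ _ (a ^+ M / M`!%:R * series (exp_coeff a) (n - M)%N)).
  rewrite (le_trans (ler_norm_sum _ _ _))// -{1}[M]add0n big_addn /series /=.
  rewrite mulr_sumr ler_sum// => k _; apply: le_trans (ua _) _.
  rewrite /exp_coeff /= exprD mulrCA -!mulrA ler_wpM2l ?exprn_ge0//.
  rewrite ler_wpM2l ?exprn_ge0// -invfM.
  rewrite lef_pV2 ?posrE ?mulr_gt0 ?ltr0n ?fact_gt0//.
  rewrite -natrM ler_nat -(@bin_fact (k + M) k) ?leq_addr// addKn.
  by rewrite mulnC leq_pmull// bin_gt0 leq_addr.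
rewrite ler_wpM2l ?mulr_ge0 ?invr_ge0 ?exprn_ge0//.
apply: nondecreasing_cvgn_le; last exact: is_cvg_series_exp_coeff.
by apply: nondecreasing_series => k _ _; exact: exp_coeff_ge0.
Unshelve. all: by end_near. Qed.

(** The coefficient of [t ^+ j] is [i ^ j / j!] with [i] the imaginary unit, since the cosine and
    sine coefficients at 1 are its real and imaginary parts. *)
Definition taylor_expi (M : nat) (t : R) : R[i] :=
  \sum_(j < M) Complex (cos_coeff 1 j) (sin_coeff 1 j) * (t ^+ j)%:C%C.

Lemma Re_sum (I : Type) (s : seq I) (F : I -> R[i]) :
  complex.Re (\sum_(i <- s) F i) = \sum_(i <- s) complex.Re (F i).
Proof. by elim/big_rec2 : _ => // i y1 y2 _ <-; rewrite Re_add. Qed.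

Lemma Im_sum (I : Type) (s : seq I) (F : I -> R[i]) :
  complex.Im (\sum_(i <- s) F i) = \sum_(i <- s) complex.Im (F i).
Proof. by elim/big_rec2 : _ => // i y1 y2 _ <-; rewrite Im_add. Qed.

Lemma normc_expi_taylor (M : nat) (a t : R) : `|t| <= a ->
  normc (expi t - taylor_expi M t) <= 2 * (a ^+ M / M`!%:R * expR a).
Proof.
move=> ta; have a0 : 0 <= a by exact: le_trans ta.
apply: le_trans (normc_le_ReIm _) _; rewrite mulr_natl mulr2n.
(* One estimate serves both series: [e] is the parity test selecting the nonzero terms, and the
   exponent [m] only affects the sign. *)
have bound (e : nat -> bool) (m k : nat) :
    `|(e k)%:R * (-1) ^+ m * t ^+ k / k`!%:R| <= exp_coeff a k.
  rewrite /exp_coeff /= normrM normfV normr_nat ler_wpM2r ?invr_ge0//.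
  rewrite !normrM normr_nat normrX normrN1 expr1n mulr1 normrX.
  by case: (e k); rewrite ?mul1r ?mul0r ?exprn_ge0// lerXn2r ?nnegrE.
apply: lerD.
- rewrite Re_add.
  rewrite [complex.Re (- _)](_ : _ = - series (cos_coeff t) M); last first.
    rewrite /series /= big_mkord /taylor_expi.
    rewrite (_ : complex.Re (- _) = - complex.Re (\sum_(j < M)
      Complex (cos_coeff 1 j) (sin_coeff 1 j) * (t ^+ j)%:C%C)); last first.
      by case: (\sum_(j < M) _).
    rewrite Re_sum; congr (- _); apply: eq_bigr => j _.
    by rewrite Re_mul /= mulr0 subr0 /cos_coeff /= expr1n mulr1 mulrAC.
  rewrite /= cos.unlock; apply: series_exp_tail => //.
    exact: is_cvg_series_cos_coeff.
  by move=> k; exact: (bound (fun k => ~~ odd k)).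
- rewrite Im_add.
  rewrite [complex.Im (- _)](_ : _ = - series (sin_coeff t) M); last first.
    rewrite /series /= big_mkord /taylor_expi.
    rewrite (_ : complex.Im (- _) = - complex.Im (\sum_(j < M)
      Complex (cos_coeff 1 j) (sin_coeff 1 j) * (t ^+ j)%:C%C)); last first.
      by case: (\sum_(j < M) _).
    rewrite Im_sum; congr (- _); apply: eq_bigr => j _.
    by rewrite Im_mul /= mulr0 add0r /sin_coeff /= expr1n mulr1 mulrAC.
  rewrite /= sin.unlock; apply: series_exp_tail => //.
    exact: is_cvg_series_sin_coeff.
  by move=> k; exact: (bound odd).
Qed.

End Taylor.

(** * Pythagoras' theorem for finite orthonormal families *)

Section Orthonormal.
Context {R : realType} {d : nat}.
Local Notation leb := (@lebesgue_measureRd R d).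
Local Notation C := R[i].
Implicit Types (g h v : Rd R d -> C).

Lemma integrable_normc_sqr g : inL2 g ->
  leb.-integrable setT (EFin \o (fun x => normc (g x) ^+ 2)).
Proof.
move=> [mg g2]; apply/integrableP; split.
  by apply/measurable_EFinP; exact: measurable_normc_sqr.
apply: le_lt_trans g2; rewrite le_eqVlt; apply/orP; left; apply/eqP.
by apply: eq_integral => x _; rewrite gee0_abs// lee_fin sqr_ge0.
Qed.

Lemma cintegrable_inner g h : inL2 g -> inL2 h ->
  cintegrable (fun x => g x * (h x)^*%C).
Proof.
move=> L2g L2h; have [mg _] := L2g; have [mh _] := L2h.
apply: (@cintegrable_le _ _ _
    (fun x => normc (g x) ^+ 2 + normc (h x) ^+ 2)).
- by apply: cmeasurableM => //; exact: cmeasurable_conj.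
- exact: (integrableD measurableT (integrable_normc_sqr L2g)
    (integrable_normc_sqr L2h)).
- move=> x; rewrite normcM normc_conj.
  have := sqr_ge0 (normc (g x) - normc (h x)).
  have := normc_ge0 (g x); have := normc_ge0 (h x).
  move: (normc (g x)) (normc (h x)) => a b; nra.
Qed.

(** The squared modulus expands into the double sum of the [G i j]; integrating term by term,
    orthonormality leaves only the diagonal. *)
Lemma sqnorm_orthonormal n (v : 'I_n -> Rd R d -> C) (c : 'I_n -> C) :
  (forall i, inL2 (v i)) -> Defs.orthonormal v ->
  leb.-integrable setT
    (EFin \o (fun x => normc (\sum_i c i * v i x) ^+ 2)) /\
  sqnorm (fun x => \sum_i c i * v i x) = (\sum_i normc (c i) ^+ 2)%:E.
Proof.
move=> L2v ov.
pose G i j x := (c i * (c j)^*%C) * (v i x * (v j x)^*%C).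
have iG i j : cintegrable (G i j).
  by apply: cintegrableZ; exact: cintegrable_inner.
have E x : ((normc (\sum_i c i * v i x) ^+ 2)%:C)%C = \sum_i \sum_j G i j x.
  rewrite normc_sqr_conj rmorph_sum /= mulr_suml; apply: eq_bigr => i _.
  rewrite mulr_sumr; apply: eq_bigr => j _; rewrite rmorphM /= /G.
  by rewrite -!mulrA; congr (_ * _); rewrite mulrCA.
have iS : cintegrable (fun x => ((normc (\sum_i c i * v i x) ^+ 2)%:C)%C).
  rewrite (_ : (fun x => _) = fun x => \sum_i \sum_j G i j x); last first.
    by apply/funext => x; exact: E.
  by do 2 (apply: cintegrable_sum => ?); exact: iG.
have [i1 _] := iS; split; first exact: i1.
rewrite /sqnorm -[LHS]fineK; last exact: (integrable_fin_num measurableT i1).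
congr EFin.
(* The real integral is viewed as the real part of a complex one, because the individual terms
   [G i j] are complex. *)
transitivity (complex.Re
    (cintegral (fun x => ((normc (\sum_i c i * v i x) ^+ 2)%:C)%C))).
  by [].
under [in LHS]eq_fun do rewrite E.
rewrite cintegral_sum; last by move=> i; exact: cintegrable_sum.
rewrite Re_sum; apply: eq_bigr => i _.
rewrite cintegral_sum// (bigD1 i)//= big1 ?addr0; last first.
  move=> j ji; rewrite cintegralZ; last exact: cintegrable_inner.
  have -> : cintegral (fun x => v i x * (v j x)^*%C) = inner (v i) (v j) by [].
  by rewrite ov eq_sym (negbTE ji) mulr0.
rewrite cintegralZ; last exact: cintegrable_inner.
have -> : cintegral (fun x => v i x * (v i x)^*%C) = inner (v i) (v i) by [].
by rewrite ov eqxx mulr1 -normc_sqr_conj.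
Qed.

End Orthonormal.

(** * Monomials and combinations with vanishing moments *)

Section Moments.
Context {R : realType}.

Definition monomial d M (al : {ffun 'I_d -> 'I_M}) (x : Rd R d) : R :=
  \prod_(k < d) (tnth x k : R) ^+ al k.

(** Expanding the power sums over maps [ph] choosing a coordinate for each of the [j] factors; the
    exponent of coordinate [k] is the size of its fibre, at most [j]. The point [x] enters the
    coefficients only, while the monomials in [xi] range over a family of [M ^ d] elements. *)
Lemma dotRd_expr d M (j : nat) (x : Rd R d) : (j < M)%N ->
  exists (al : {ffun 'I_j -> 'I_d} -> {ffun 'I_d -> 'I_M})
    (b : {ffun 'I_j -> 'I_d} -> R),
  forall xi, dotRd x xi ^+ j = \sum_ph b ph * monomial (al ph) xi.
Proof.
move=> jM.
have cardM (ph : {ffun 'I_j -> 'I_d}) k : (#|[pred l | ph l == k]| < M)%N.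
  by rewrite (leq_ltn_trans (max_card _))// card_ord.
exists (fun ph => [ffun k => Ordinal (cardM ph k)]).
exists (fun ph => \prod_l (tnth x (ph l) : R)) => xi.
rewrite -[j in LHS]card_ord -prodr_const /dotRd bigA_distr_bigA /=.
apply: eq_bigr => ph _; rewrite big_split /=; congr (_ * _).
rewrite (partition_big ph xpredT)//=; apply: eq_bigr => k _.
rewrite ffunE /= -prodr_const; apply: eq_big => [l|l /eqP ->]//.
Qed.

Lemma measurable_monomial d M (al : {ffun 'I_d -> 'I_M}) :
  measurable_fun setT (monomial al).
Proof.
apply: measurable_prod => k _; apply: measurable_funX; exact: measurable_tnth.
Qed.

Lemma normr_monomial_le d M (al : {ffun 'I_d -> 'I_M}) N x :
  @cube R d N x -> `|monomial al x| <= \prod_(k < d) N%:R ^+ al k.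
Proof.
move=> xN; rewrite normr_prod; apply: ler_prod => k _.
by rewrite normr_ge0 normrX lerXn2r ?nnegrE.
Qed.

Lemma normr_dotRd_le d N (x xi : Rd R d) : cube N x -> cube N xi ->
  `|dotRd x xi| <= d%:R * N%:R ^+ 2.
Proof.
move=> xN xiN; rewrite (le_trans (ler_norm_sum _ _ _))//.
have -> : d%:R * N%:R ^+ 2 = \sum_(i < d) N%:R ^+ 2 :> R.
  by rewrite sumr_const card_ord mulr_natl.
by apply: ler_sum => i _; rewrite normrM expr2 ler_pM.
Qed.

(** A matrix with more rows than columns has a nonzero left kernel vector, which is then
    normalised. *)
Lemma exists_vanishing_moments n m (L : 'I_n -> 'I_m -> R[i]) : (m < n)%N ->
  exists c : 'I_n -> R[i], \sum_i normc (c i) ^+ 2 = 1 /\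
    forall al, \sum_i c i * L i al = 0.
Proof.
move=> mn; pose Lm := \matrix_(i < n, al < m) L i al.
have [c cL c0] : exists2 c : 'rV[R[i]]_n, c *m Lm = 0 & c != 0.
  have /rowV0Pn[c] : kermx Lm != 0.
    rewrite -mxrank_eq0 mxrank_ker subn_eq0 -ltnNge.
    by rewrite (leq_ltn_trans (rank_leq_col _)).
  by move/sub_kermxP => cL c0; exists c.
pose s := \sum_i normc (c 0 i) ^+ 2.
have s0 : 0 < s.
  rewrite lt_def sumr_ge0 ?andbT; last by move=> i _; exact: sqr_ge0.
  apply: contra c0 => /eqP; move/psumr_eq0P => H.
  apply/eqP/rowP => i; rewrite mxE; apply/eq0_normc/eqP.
  by rewrite -sqrf_eq0 H// => k _; exact: sqr_ge0.
exists (fun i => ((Num.sqrt s)^-1)%:C%C * c 0 i); split.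
  under eq_bigr do rewrite normcM exprMn normc_real.
  rewrite -mulr_sumr -/s ger0_norm ?invr_ge0 ?sqrtr_ge0//.
  by rewrite exprVn sqr_sqrtr ?ltW// mulVf ?gt_eqF.
move=> al; under eq_bigr do rewrite -mulrA.
rewrite -mulr_sumr; have /rowP/(_ al) := cL; rewrite !mxE.
by under eq_bigr do rewrite mxE; move=> ->; rewrite mulr0.
Qed.

End Moments.

(** * From low rank approximation to eigenvalue bounds *)

Section EigenvalueBound.
Context {R : realType} {d : nat}.
Local Notation leb := (@lebesgue_measureRd R d).
Local Notation C := R[i].
Implicit Types (g h v p : Rd R d -> C).

Section BoundedSets.
Variables (N : nat) (A B : set (Rd R d)).
Hypotheses (mA : measurable A) (AN : A `<=` cube N).
Hypotheses (mB : measurable B) (BN : B `<=` cube N).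

Lemma lebesgue_measureRd_fin (D : set (Rd R d)) :
  measurable D -> D `<=` cube N -> (leb D < +oo)%E.
Proof.
move=> mD DN; apply: le_lt_trans (@lebesgue_measureRd_cube R d N).
by apply: le_measure => //; rewrite inE//; exact: measurable_cube.
Qed.

Lemma integrable_indic1 (D : set (Rd R d)) : measurable D -> D `<=` cube N ->
  leb.-integrable setT (EFin \o (\1_D : Rd R d -> R)).
Proof.
move=> mD DN; apply/integrableP; split.
  by apply/measurable_EFinP; exact: measurable_indic.
under eq_integral do rewrite gee0_abs ?lee_fin//.
by rewrite integral_indic// setIT; exact: lebesgue_measureRd_fin.
Qed.

Lemma integrable_indicZ (D : set (Rd R d)) (b : R) : measurable D ->
  D `<=` cube N -> leb.-integrable setT (EFin \o (fun x => b * \1_D x)).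
Proof.
by move=> mD DN; exact: (integrableZl measurableT b (integrable_indic1 mD DN)).
Qed.

Lemma Rintegral_indicZ (D : set (Rd R d)) (b : R) : measurable D ->
  D `<=` cube N -> \int[leb]_x (b * \1_D x) = b * fine (leb D).
Proof.
move=> mD DN; rewrite RintegralZl//; last exact: integrable_indic1.
by rewrite /Rintegral integral_indic// setIT.
Qed.

Lemma cintegrable_bounded p h (b H : R) : cmeasurable p -> cmeasurable h ->
  (forall x, B x -> normc (p x) <= b) -> (forall x, normc (h x) <= H) ->
  cintegrable (fun x => p x * PP B h x) /\
  normc (cintegral (fun x => p x * PP B h x)) <= 2 * (b * H * fine (leb B)).
Proof.
move=> mp mh pb hH.
have m : cmeasurable (fun x => p x * PP B h x).
  by apply: cmeasurableM => //; exact: cmeasurable_PP.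
have le x : normc (p x * PP B h x) <= b * H * \1_B x.
  rewrite /PP !normcM normc_real indicE; have [|_] := boolP (x \in B).
    rewrite inE => Bx; rewrite normr1 mul1r mulr1 ler_pM ?normc_ge0//.
    exact: pb.
  by rewrite normr0 mul0r !mulr0.
split; first exact: (cintegrable_le m (integrable_indicZ (b * H) mB BN)).
rewrite -Rintegral_indicZ//; apply: normc_cintegral_le => //.
exact: integrable_indicZ.
Qed.

(** By the inequality [a <= 1 + a ^ 2], square integrable functions become integrable on a set of
    finite measure. The factor 1 matches the form of [integrable_indicZ]. *)
Lemma normc_PP_le g x : normc (PP A g x) <= 1 * \1_A x + normc (g x) ^+ 2.
Proof.
rewrite /PP normcM normc_real mul1r indicE; case: (x \in A) => /=.
  rewrite normr1 mul1r; have := sqr_ge0 (normc (g x) - 1).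
  have := normc_ge0 (g x); move: (normc _) => a; nra.
by rewrite normr0 mul0r add0r sqr_ge0.
Qed.

Lemma normc_fourier_PP_le g xi : cmeasurable g ->
  leb.-integrable setT (EFin \o (fun x => normc (g x) ^+ 2)) ->
  normc (fourier_integral (-1) (PP A g) xi) <=
    2 * (fine (leb A) + \int[leb]_x (normc (g x) ^+ 2)).
Proof.
move=> mg ig; rewrite -[fine (leb A)]mul1r -Rintegral_indicZ//.
rewrite -RintegralD//; last first.
  exact: integrable_indicZ.
apply: normc_cintegral_le.
- apply: cmeasurableM; last exact: cmeasurable_PP.
  apply: cmeasurable_expi; apply: measurable_funM => //.
  exact: measurable_dotRdr.
- exact: (integrableD measurableT (integrable_indicZ 1 mA AN) ig).
- by move=> x; rewrite normcM normc_expi mul1r; exact: normc_PP_le.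
Qed.

Lemma cintegrable_fourier_PP g s xi : inL2 g ->
  cintegrable (fun x => expi (s * 2 * pi * dotRd x xi) * PP A g x).
Proof.
move=> L2g; have [mg _] := L2g.
apply: (@cintegrable_le _ _ _ (fun x => 1 * \1_A x + normc (g x) ^+ 2)).
- apply: cmeasurableM; last exact: cmeasurable_PP.
  apply: cmeasurable_expi; apply: measurable_funM => //.
  exact: measurable_dotRdr.
- exact: (integrableD measurableT (integrable_indicZ 1 mA AN)
    (integrable_normc_sqr L2g)).
- by move=> x; rewrite normcM normc_expi mul1r; exact: normc_PP_le.
Qed.

(* A truncated Taylor expansion of the exponential splits the operator into an
   operator of rank at most [M ^ d], which vanishes on the chosen combination,
   and a remainder that is superexponentially small in [M]. *)
Lemma SS_borel_combination n M (v : 'I_n -> Rd R d -> C) :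
  (M ^ d < n)%N -> (forall i, inL2 (v i)) -> Defs.orthonormal v ->
  let a : R := 2 * pi * (d%:R * N%:R ^+ 2) in
  exists c : 'I_n -> C, \sum_i normc (c i) ^+ 2 = 1 /\
    forall x, normc (\sum_i c i * SS_borel A B (v i) x) <=
      8 * (fine (leb A) + 1) * fine (leb B) * expR a * (a ^+ M / M`!%:R) *
      \1_A x.
Proof.
move=> Mn L2v ov a.
pose hat i := fourier_integral (-1) (PP A (v i)).
have mhat i : cmeasurable (hat i).
  by apply: cmeasurable_fourier_integral; apply: cmeasurable_PP => //;
    have [] := L2v i.
pose H0 i := 2 * (fine (leb A) + \int[leb]_x (normc (v i x) ^+ 2)).
have hatH i x : normc (hat i x) <= H0 i.
  have [mv _] := L2v i.
  by apply: normc_fourier_PP_le => //; exact: integrable_normc_sqr.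
(* Moments over [B] of the transforms of the [v i]. There are [M ^ d < n] exponents [al], so some
   unit vector [c] annihilates all of them. *)
pose L i al :=
  cintegral (fun xi => (@monomial R d M al xi)%:C%C * PP B (hat i) xi).
have [|c [c1 cL]] := @exists_vanishing_moments R n #|{ffun 'I_d -> 'I_M}|
    (fun i k => L i (enum_val k)).
  by rewrite card_ffun !card_ord.
have {}cL al : \sum_i c i * L i al = 0.
  by have := cL (enum_rank al); rewrite enum_rankK.
exists c; split => // x.
pose h xi := \sum_i c i * hat i xi.
have mh : cmeasurable h.
  by apply: cmeasurable_sum => i; apply: cmeasurableM => //;
    exact: cmeasurable_cst.
pose w y := \sum_i c i * v i y.
have [iw sw] := sqnorm_orthonormal c L2v ov.
have mw : cmeasurable w.
  apply: cmeasurable_sum => i; apply: cmeasurableM.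
    exact: cmeasurable_cst.
  by have [] := L2v i.
(* By linearity [h] is the transform of the single function [w], which has norm 1; hence the next
   bound depends neither on [n] nor on the [v i]. *)
have hE xi : h xi = fourier_integral (-1) (PP A w) xi.
  rewrite /h /hat /fourier_integral.
  under eq_bigr => i _ do
    rewrite -(cintegralZ (c i) (cintegrable_fourier_PP (-1) xi (L2v i))).
  rewrite -cintegral_sum; last first.
    by move=> i; apply: cintegrableZ; exact: cintegrable_fourier_PP.
  congr cintegral; apply/funext => y; rewrite /PP /w !mulr_sumr.
  by apply: eq_bigr => i _; rewrite mulrCA; congr (_ * _); rewrite mulrCA.
have hH xi : normc (h xi) <= 2 * (fine (leb A) + 1).
  rewrite hE (le_trans (normc_fourier_PP_le xi mw iw))//.
  by rewrite /Rintegral -/(sqnorm w) sw /= c1.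
have PBh p xi : p xi * PP B h xi = \sum_i c i * (p xi * PP B (hat i) xi).
  rewrite /PP /h !mulr_sumr; apply: eq_bigr => i _.
  by ring.
have moment al :
    cintegral (fun xi => (@monomial R d M al xi)%:C%C * PP B h xi) = 0.
  under eq_fun do rewrite (PBh (fun xi => (monomial al xi)%:C%C)).
  have ci i : cintegrable
      (fun xi => (monomial al xi)%:C%C * PP B (hat i) xi).
    apply: (cintegrable_bounded (b := \prod_(k < d) N%:R ^+ al k)
      (H := H0 i) _ _ _ _).1 => //.
    - by apply: cmeasurable_real; exact: measurable_monomial.
    - by move=> y By; rewrite normc_real; apply: normr_monomial_le; exact: BN.
  rewrite cintegral_sum; last by move=> i; exact: cintegrableZ.
  by rewrite -[RHS](cL al); apply: eq_bigr => i _; rewrite cintegralZ.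
have imon al : cintegrable (fun xi => (@monomial R d M al xi)%:C%C * PP B h xi).
  apply: (cintegrable_bounded (b := \prod_(k < d) N%:R ^+ al k)
    (H := 2 * (fine (leb A) + 1)) _ _ _ _).1 => //.
  - by apply: cmeasurable_real; exact: measurable_monomial.
  - by move=> y By; rewrite normc_real; apply: normr_monomial_le; exact: BN.
pose th xi := 1 * 2 * pi * dotRd x xi.
(* For fixed [x] the Taylor polynomial is a combination of monomials in [xi] of exponents below [M],
   so its integral against [PP B h] vanishes. *)
have taylor0 : cintegrable (fun xi => taylor_expi M (th xi) * PP B h xi) /\
    cintegral (fun xi => taylor_expi M (th xi) * PP B h xi) = 0.
  have [G [iG G0 GE]] : exists G : 'I_M -> Rd R d -> C,
      [/\ forall j, cintegrable (G j), forall j, cintegral (G j) = 0 &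
       forall xi, taylor_expi M (th xi) * PP B h xi = \sum_j G j xi].
    exists (fun j xi => Complex (cos_coeff 1 j) (sin_coeff 1 j) *
       (th xi ^+ j)%:C%C * PP B h xi).
    have key (j : 'I_M) : exists F : {ffun 'I_j -> 'I_d} -> Rd R d -> C,
      [/\ forall ph, cintegrable (F ph), forall ph, cintegral (F ph) = 0 &
        forall xi, Complex (cos_coeff 1 j) (sin_coeff 1 j) *
       (th xi ^+ j)%:C%C * PP B h xi = \sum_ph F ph xi].
      have [al [b E]] := @dotRd_expr R d M j x (ltn_ord j).
      exists (fun ph xi => (Complex (cos_coeff 1 j) (sin_coeff 1 j) *
        ((1 * 2 * pi) ^+ j * b ph)%:C%C) *
        ((monomial (al ph) xi)%:C%C * PP B h xi)); split.
      - by move=> ph; exact: cintegrableZ.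
      - by move=> ph; rewrite cintegralZ// moment mulr0.
      - move=> xi; rewrite /th exprMn E mulr_sumr rmorph_sum mulr_sumr.
        rewrite mulr_suml; apply: eq_bigr => ph _.
        rewrite mulrA [in RHS]mulrA -!mulrA; congr (_ * _).
        by rewrite !rmorphM /= !mulrA.
    split.
    - move=> j; have [F [iF _ FE]] := key j; under eq_fun do rewrite FE.
      exact: cintegrable_sum.
    - move=> j; have [F [iF F0 FE]] := key j; under eq_fun do rewrite FE.
      by rewrite cintegral_sum// big1.
    - by move=> xi; rewrite /taylor_expi mulr_suml.
  rewrite (_ : (fun xi => taylor_expi M (th xi) * PP B h xi) =
    fun xi => \sum_j G j xi); last exact/funext.
  by split; [exact: cintegrable_sum|rewrite cintegral_sum// big1].
have [iT T0] := taylor0.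
have mdot : measurable_fun setT th.
  by apply: measurable_funM => //; exact: measurable_dotRdl.
have mE : cmeasurable (fun xi => expi (th xi)) by exact: cmeasurable_expi.
have iE i : cintegrable (fun xi => expi (th xi) * PP B (hat i) xi).
  apply: (cintegrable_bounded (b := 1) (H := H0 i) _ _ _ _).1 => //.
  by move=> y _; rewrite normc_expi.
have SE : \sum_i c i * SS_borel A B (v i) x =
    (\1_A x : R)%:C%C * cintegral (fun xi => expi (th xi) * PP B h xi).
  transitivity (\sum_i (\1_A x : R)%:C%C *
      (c i * cintegral (fun xi => expi (th xi) * PP B (hat i) xi))).
    apply: eq_bigr => i _; rewrite mulrCA; congr (_ * (_ * _)).
    rewrite /SS_borel /fourier_integral; congr cintegral; apply/funext => xi.
    congr (expi (_ * _) * _).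
    by rewrite /dotRd; apply: eq_bigr => k _; rewrite mulrC.
  rewrite -mulr_sumr; congr (_ * _).
  under [in RHS]eq_fun do rewrite (PBh (fun xi => expi (th xi))).
  rewrite cintegral_sum; last by move=> i; exact: cintegrableZ.
  by apply: eq_bigr => i _; rewrite cintegralZ.
rewrite SE normcM normc_real indicE; have [|_] := boolP (x \in A); last first.
  by rewrite normr0 mul0r mulr0.
rewrite inE => Ax; rewrite normr1 mul1r mulr1.
have mT : cmeasurable (fun xi => taylor_expi M (th xi)).
  apply: cmeasurable_sum => j; apply: cmeasurableM; first exact: cmeasurable_cst.
  by apply: cmeasurable_real; exact: measurable_funX.
have iEh : cintegrable (fun xi => expi (th xi) * PP B h xi).
  apply: (cintegrable_bounded (b := 1) (H := 2 * (fine (leb A) + 1)) _ _ _ _).1 => //.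
  by move=> y _; rewrite normc_expi.
(* The Taylor polynomial can be subtracted without changing the integral, leaving only the remainder
   [D] to estimate. *)
pose D xi := expi (th xi) + (-1) * taylor_expi M (th xi).
have -> : cintegral (fun xi => expi (th xi) * PP B h xi) =
    cintegral (fun xi => D xi * PP B h xi).
  transitivity (cintegral (fun xi => expi (th xi) * PP B h xi) +
      (-1) * cintegral (fun xi => taylor_expi M (th xi) * PP B h xi)).
    by rewrite T0 mulr0 addr0.
  rewrite -cintegralZ// -cintegralD//; last exact: cintegrableZ.
  by congr cintegral; apply/funext => xi; rewrite /D mulrDl mulrA.
have mD : cmeasurable D.
  by apply: cmeasurableD => //; apply: cmeasurableM => //; exact: cmeasurable_cst.
(* Both [x] and [xi] lie in [cube N], so the phase [th xi] is bounded by [a]. *)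
have DB xi : B xi -> normc (D xi) <= 2 * (a ^+ M / M`!%:R * expR a).
  move=> Bxi; rewrite /D mulN1r; apply: normc_expi_taylor.
  have p0 : 0 <= 2 * pi :> R by rewrite mulr_ge0// pi_ge0.
  rewrite /th mul1r /a normrM ger0_norm// ler_wpM2l//.
  by apply: normr_dotRd_le; [exact: AN|exact: BN].
apply: le_trans (cintegrable_bounded mD mh DB hH).2 _.
(* The constant 8 collects three factors 2: from the Taylor remainder, from the bound on [h] and
   from [normc_cintegral_le]. *)
rewrite le_eqVlt; apply/orP; left; apply/eqP.
by move: (fine (leb B)) (fine (leb A)) => X Y; ring.
Qed.

End BoundedSets.

(** Given [k + 1] orthonormal eigenvectors with eigenvalues at least [t > 0], the image of any unit
    combination has norm at least [t]; for the combination from [SS_borel_combination] that image is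
    tiny. *)
Lemma eigenvalue_SS_le (A B : set (Rd R d)) :
  lebesgue_measurableRd A -> boundedRd A ->
  lebesgue_measurableRd B -> boundedRd B ->
  exists C a : R, [/\ 0 <= C, 0 <= a & forall k M, (M ^ d <= k)%N ->
    0 <= Defs.eigenvalue (SS A B) k <= C * (a ^+ M / M`!%:R)].
Proof.
move=> mA bA mB bB.
have [NA [A0 [mA0 ANA A0NA nA]]] := bounded_borel_version mA bA.
have [NB [B0 [mB0 BNB B0NB nB]]] := bounded_borel_version mB bB.
have cubeS (m n : nat) : (m <= n)%N -> @cube R d m `<=` cube n.
  by move=> mn x xm i; rewrite (le_trans (xm i))// ler_nat.
pose N := maxn NA NB.
have AN : A0 `<=` cube N by apply: subset_trans A0NA _; exact/cubeS/leq_maxl.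
have BN : B0 `<=` cube N by apply: subset_trans B0NB _; exact/cubeS/leq_maxr.
pose a : R := 2 * pi * (d%:R * N%:R ^+ 2).
pose lA := fine (leb A0); pose E := 8 * (lA + 1) * fine (leb B0) * expR a.
have a0 : 0 <= a by rewrite !mulr_ge0// ?pi_ge0// exprn_ge0.
have lA0 : 0 <= lA by exact: fine_ge0.
have E0 : 0 <= E by rewrite !mulr_ge0 ?expR_ge0 ?addr_ge0// fine_ge0.
(* The factor [1 + lA] dominates the square root of the measure of [A0], which appears on passing
   from the uniform to the L^2 bound. *)
exists (E * (1 + lA)), a; split => //; first by rewrite mulr_ge0// addr_ge0.
move=> k M Mk; set e := a ^+ M / _.
have em0 : 0 <= e by rewrite mulr_ge0 ?invr_ge0// exprn_ge0.
pose bnd := E * (1 + lA) * e; rewrite -/bnd.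
have bnd0 : 0 <= bnd by do 2 apply: mulr_ge0 => //; exact: addr_ge0.
(* The upper bound yields both inequalities: the set contains 0, and being bounded it lies below its
   supremum. *)
suff ub : ubound [set t | t = 0 \/
    exists (mu : 'I_k.+1 -> R) (v : 'I_k.+1 -> Rd R d -> C),
      [/\ forall i, eigenvector (SS A B) (mu i) (v i), Defs.orthonormal v &
          forall i, t <= mu i]] bnd.
  apply/andP; split.
  - by apply: ub_le_sup; [exists bnd|left].
  - by apply: ge_sup => //; exists 0; left.
move=> t /= [->//|[mu [v [ev ov tmu]]]].
have [t0|t0] := leP t 0; first exact: le_trans bnd0.
have L2v i : inL2 (v i) by have [] := ev i.
have [c [c1 cS]] := SS_borel_combination mA0 AN mB0 BN
  (Mk : (M ^ d < k.+1)%N) L2v ov.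
rewrite -/a -/lA -/E -/e in cS.
pose u x := \sum_i (c i * (mu i)%:C%C) * v i x.
have [iu su] := sqnorm_orthonormal (fun i => c i * (mu i)%:C%C) L2v ov.
have mu_ : cmeasurable u.
  apply: cmeasurable_sum => i; apply: cmeasurableM.
    exact: cmeasurable_cst.
  by have [] := L2v i.
(* There are finitely many eigenvectors, so their exceptional null sets can be merged. *)
have aeu : {ae leb, forall x, u x = \sum_i c i * SS_borel A0 B0 (v i) x}.
  have : \forall x \ae leb, forall i,
      SS_borel A0 B0 (v i) x = (mu i)%:C%C * v i x.
    apply: filter_forall => i; have [_ evi] := ev i.
    have [mv _] := L2v i.
    have := SS_ae mA0 mB0 ANA BNB nA nB mv.
    by apply: filterS2 evi => x /= H1 H2; rewrite -H1// H2.
  apply: filterS => x H; apply: eq_bigr => i _.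
  by rewrite H mulrA.
have le1 : (sqnorm u <= \int[leb]_x ((E * e) ^+ 2 * \1_A0 x)%:E)%E.
  apply: ae_ge0_le_integral => //.
  - by move=> x _; rewrite lee_fin sqr_ge0.
  - by apply/measurable_EFinP; exact: measurable_normc_sqr.
  - by move=> x _; rewrite lee_fin mulr_ge0// sqr_ge0.
  - by apply/measurable_EFinP; apply: measurable_funM => //;
      exact: measurable_indic.
  - apply: filterS aeu => x ux _; rewrite lee_fin ux.
    apply: (@le_trans _ _ ((E * e * \1_A0 x) ^+ 2)).
      by rewrite lerXn2r ?nnegrE ?normc_ge0// ?cS// mulr_ge0// mulr_ge0.
    rewrite exprMn ler_wpM2l ?sqr_ge0// indicE.
    by case: (_ \in _); rewrite ?expr1n// expr0n.
(* The squared norm of [u] is the sum of [|c i| ^ 2 (mu i) ^ 2], at least [t ^ 2] because each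
   [mu i >= t > 0] and [c] has norm 1. *)
have le2 : t ^+ 2 <= (E * e) ^+ 2 * lA.
  have le1' : \sum_i normc (c i * (mu i)%:C%C) ^+ 2 <= (E * e) ^+ 2 * lA.
    rewrite -lee_fin -su (le_trans le1)// -[leLHS]fineK; last first.
      exact: (integrable_fin_num measurableT (integrable_indicZ _ mA0 AN)).
    rewrite lee_fin le_eqVlt; apply/orP; left; apply/eqP.
    exact: (Rintegral_indicZ ((E * e) ^+ 2) mA0 AN).
  apply: le_trans le1'.
  rewrite -[t ^+ 2]mulr1 -c1 mulr_sumr ler_sum// => i _.
  rewrite normcM exprMn normc_real mulrC ler_wpM2l ?sqr_ge0//.
  rewrite real_normK ?num_real// lerXn2r ?nnegrE ?(ltW t0)//.
  by rewrite (le_trans (ltW t0)).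
rewrite -(@ler_pXn2r _ 2)// ?nnegrE ?(ltW t0)//.
apply: le_trans le2 _; rewrite (_ : bnd = E * e * (1 + lA)) /bnd; last first.
  by rewrite mulrAC.
by rewrite [leRHS]exprMn ler_wpM2l ?sqr_ge0// expr2; nra.
Qed.

End EigenvalueBound.

(** * Summation against the admissibility integral *)

Section Admissible.
Context {R : realType}.
Local Notation mu := (@lebesgue_measure R).
Implicit Types (f : R -> R[i]).

Lemma M0_nondecreasing f (s t : R) : s <= t -> (M0 f s <= M0 f t)%E.
Proof.
move=> st; apply: ereal_sup_le => _ [x /= xs <-]; exists x => //=.
by move: xs; rewrite !in_itv /= => /andP[-> /le_trans]; exact.
Qed.

Lemma M0_ge f (x t : R) : 0 <= x <= t -> ((normc (f x))%:E <= M0 f t)%E.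
Proof. by move=> xt; apply: ereal_sup_ubound; exists x. Qed.

Lemma M0_ge0 f (t : R) : 0 <= t -> (0 <= M0 f t)%E.
Proof.
move=> t0; apply: le_trans (@M0_ge f 0 t _); rewrite ?lexx//.
by rewrite lee_fin normc_ge0.
Qed.

(** Preimages of upper rays under a monotone function are intervals. This is what makes [M0 f]
    measurable for arbitrary [f]. *)
Lemma nondecreasing_emeasurable (g : R -> \bar R) :
  {homo g : x y / x <= y >-> (x <= y)%E} -> measurable_fun setT g.
Proof.
move=> ndg _; apply: (measurability _ (ErealGenCInfty.measurableE R)) => //.
move=> _ [_ [r ->] <-]; rewrite setTI; apply: is_interval_measurable.
move=> x y /=; rewrite !in_itv /= !andbT => rx _ z /andP[xz _].
by rewrite in_itv /= andbT (le_trans rx)// ndg.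
Qed.

Definition admissible_weight (d : nat) (e : R) : R :=
  ln e^-1 ^+ d.-1 / (e * ln (ln e^-1) ^+ d).

Lemma lnln_gt0 (delta e : R) : delta < expR (-1) -> 0 < e < delta ->
  1 < ln e^-1 /\ 0 < ln (ln e^-1).
Proof.
move=> dE /andP[e0 ed]; have L1 : 1 < ln e^-1.
  rewrite lnV ?posrE// ltrNr -[ltRHS]expRK ltr_ln ?posrE ?expR_gt0//.
  exact: lt_trans dE.
by split => //; exact: ln_gt0.
Qed.

Lemma measurable_admissible_weight d (delta : R) : delta < expR (-1) ->
  measurable_fun `]0, delta[%classic (admissible_weight d).
Proof.
(* On this interval the denominator is positive, so its inverse can be written through [expR] and
   [ln], both measurable on the whole line. *)
move=> dE; apply: (@eq_measurable_fun _ _ _ _ _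
  (fun e => (- ln e) ^+ d.-1 * expR (- ln (e * ln (- ln e) ^+ d)))).
  move=> e; rewrite inE /= in_itv /= => ed; have /andP[e0 _] := ed.
  have [_ L0] := lnln_gt0 dE ed.
  rewrite /admissible_weight -lnV ?posrE// expRN lnK// posrE.
  by rewrite mulr_gt0// exprn_gt0.
have mNln : measurable_fun [set: R] (fun e : R => - ln e).
  by apply: measurable_funN; exact: measurable_ln.
apply: measurable_funTS; apply: measurable_funM; first exact: measurable_funX.
apply: measurableT_comp; first exact: measurable_expR.
apply: measurable_funN; apply: measurableT_comp; first exact: measurable_ln.
apply: measurable_funM => //; apply: measurable_funX.
by apply: measurableT_comp => //; exact: measurable_ln.
Qed.

Lemma lebesgue_measure_itvco (a b : R) : a <= b ->
  mu `[a, b[%classic = (b - a)%:E.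
Proof.
move=> ab; rewrite lebesgue_measure_itv /= lte_fin.
by case: ltP => // ba; rewrite (le_anti (introT andP (conj ab ba))) subrr.
Qed.

Definition dyadic (k : nat) : R := (2 ^+ k)^-1.

Lemma dyadic_gt0 k : 0 < dyadic k.
Proof. by rewrite invr_gt0 exprn_gt0. Qed.

Lemma le_dyadic k l : (k <= l)%N -> dyadic l <= dyadic k.
Proof.
by move=> kl; rewrite /dyadic lef_pV2 ?posrE ?exprn_gt0// ler_eXn2l// ltr1n.
Qed.

(** Each of the [n] dyadic intervals contributes at least [c / 2]: on [[2 ^ -(k+1), 2 ^ -k[] the
    integrand is at least [c 2 ^ k] and the length is [2 ^ -(k+1)]. The value [c] may be
    infinite. *)
Lemma dyadic_integral_ge (F : R -> \bar R) (c : \bar R) (p n : nat) :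
  (0 <= c)%E ->
  measurable_fun `[dyadic (p + n), dyadic p[%classic F ->
  (forall e, `[dyadic (p + n), dyadic p[%classic e ->
    (c * (e^-1)%:E <= F e)%E) ->
  ((n%:R / 2)%:E * c <= \int[mu]_(e in `[dyadic (p + n), dyadic p[) F e)%E.
Proof.
move=> c0; elim: n => [|n IH] mF cF.
  rewrite mul0r mul0e; apply: integral_ge0 => e ei; apply: le_trans (cF _ ei).
  rewrite mule_ge0// lee_fin invr_ge0; move: ei; rewrite /= in_itv /=.
  by move=> /andP[+ _]; apply: le_trans; exact/ltW/dyadic_gt0.
have le1 := le_dyadic (leq_addr n p).
have le2 : dyadic (p + n.+1) <= dyadic (p + n).
  by apply: le_dyadic; rewrite leq_add2l.
have U : `[dyadic (p + n.+1), dyadic p[%classic =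
    `[dyadic (p + n.+1), dyadic (p + n)[%classic `|`
    `[dyadic (p + n), dyadic p[%classic.
  by rewrite -itv_bndbnd_setU// bnd_simp.
have F0 e : `[dyadic (p + n.+1), dyadic p[%classic e -> (0 <= F e)%E.
  move=> ei; apply: le_trans (cF _ ei); rewrite mule_ge0// lee_fin invr_ge0.
  move: ei; rewrite /= in_itv /= => /andP[+ _].
  by apply: le_trans; exact/ltW/dyadic_gt0.
rewrite U in mF F0 cF *.
rewrite ge0_integral_setU//; last first.
  rewrite disj_set2E; apply/eqP/seteqP; split => // e /=.
  rewrite !in_itv /= => -[/andP[_ h1] /andP[h2 _]].
  by move: (lt_le_trans h1 h2); rewrite ltxx.
rewrite -[n.+1]add1n natrD mulrDl EFinD ge0_muleDl ?lee_fin ?divr_ge0//.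
apply: leeD; last first.
  apply: IH.
  - by apply: measurable_funS mF => [|x]; [exact: measurableU|right].
  - by move=> e ei; apply: cF; right.
have -> : ((1%:R / 2)%:E * c =
    \int[mu]_(e in `[dyadic (p + n.+1), dyadic (p + n)[)
      (cst (c * (2 ^+ (p + n))%:E) e))%E.
  rewrite integral_cst//; set m := (X in (_ * _ * X)%E).
  have -> : m = (dyadic (p + n) - dyadic (p + n.+1))%:E.
    exact: lebesgue_measure_itvco.
  rewrite -muleA -EFinM muleC.
  congr (_ * _)%E; congr EFin; rewrite addnS /dyadic exprS invfM.
  by field; rewrite gt_eqF// exprn_gt0.
apply: ge0_le_integral => //.
- by move=> e _; rewrite /= mule_ge0// lee_fin exprn_ge0.
- by apply: measurable_funS mF => [|x]; [exact: measurableU|left].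
- move=> e ei; apply: le_trans (cF e _); last by left.
  rewrite lee_wpmul2l// lee_fin -[leLHS]invrK lef_pV2 ?posrE ?invr_gt0//.
    by move: ei; rewrite /= in_itv /= => /andP[_ /ltW].
  move: ei; rewrite /= in_itv /= => /andP[+ _]; apply: lt_le_trans.
  exact: dyadic_gt0.
Qed.

End Admissible.

(** * Growth of factorials and of the admissibility weight *)

Section Growth.
Context {R : realType}.

(** The upper half of the product [(2 n)!] has [n] factors, all larger than [n]. *)
Lemma leq_expnn_fact n : (n ^ n <= (2 * n)`!)%N.
Proof.
rewrite (@fact_split (2 * n) n) ?leq_pmull//.
apply: leq_trans (leq_pmull _ (fact_gt0 n)).
have -> : (n ^ n = \prod_(n.+1 <= k < (2 * n).+1) n)%N.
  by rewrite prod_nat_const_nat subSS mul2n -addnn addnK.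
rewrite !big_nat; apply: leq_prod => k /andP[nk _]; exact: ltnW.
Qed.

Lemma superexponential_le (C a : R) : 0 <= C -> 0 <= a -> exists i0, forall i,
  (i0 <= i)%N ->
  C * (a ^+ (2 ^ (i + 2)) / ((2 ^ (i + 2))`!)%:R) <= @dyadic R (i * 2 ^ i).
Proof.
move=> C0 a0; pose q := Num.bound (Num.max C a).
have qP : Num.max C a <= 2 ^+ q.
  have /archi_boundP : 0 <= Num.max C a by rewrite le_max C0.
  rewrite -/q => /ltW/le_trans; apply.
  by rewrite -natrX ler_nat; exact/ltnW/ltn_expl.
have Cq : C <= 2 ^+ q by apply: le_trans qP; rewrite le_max lexx.
have aq : a <= 2 ^+ q by apply: le_trans qP; rewrite le_max lexx orbT.
(* With [C] and [a] at most [2 ^ q], comparing exponents of 2 leaves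
   [q + 4 q 2 ^ i <= (i + 2) 2 ^ i], which [i >= 8 q] ensures. *)
exists (8 * q)%N => i qi; set M := (2 ^ (i + 2))%N.
have M2 : M = (2 * 2 ^ i.+1)%N by rewrite /M addn2 expnS.
have factM : 2 ^+ (i.+1 * 2 ^ i.+1) <= (M`!)%:R :> R.
  by rewrite -natrX ler_nat M2 expnM; exact: leq_expnn_fact.
rewrite mulrA /dyadic ler_pdivrMr ?ltr0n ?fact_gt0//.
rewrite ler_pdivlMl ?exprn_gt0//; apply: le_trans factM.
apply: (@le_trans _ _ (2 ^+ (i * 2 ^ i) * (2 ^+ q * 2 ^+ (q * M)))).
  rewrite ler_wpM2l ?exprn_ge0// ler_pM ?exprn_ge0//.
  by rewrite exprM lerXn2r ?nnegrE ?exprn_ge0.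
rewrite -!exprD ler_eXn2l ?ltr1n// M2 expnS.
have : (0 < 2 ^ i)%N by rewrite expn_gt0.
by move: (2 ^ i)%N => P; nia.
Qed.

Lemma ln2_ge : 2^-1 <= ln 2 :> R.
Proof.
have := @le_ln1Dx R (- 2^-1); have -> : 1 + - 2^-1 = 2^-1 :> R by field.
rewrite lnV ?posrE// => H; rewrite -lerN2; apply: H; lra.
Qed.

Lemma ln2_le1 : ln 2 <= 1 :> R.
Proof. by have := @le_ln1Dx R 1; rewrite -natr1; apply; lra. Qed.

(** On block [i] it bounds [e] times the weight from below: there [ln (1/e) >= i 2 ^ i / 2] and
    [ln (ln (1/e)) <= 4 i]. *)
Definition weight_bound d i : R :=
  (i%:R * 2 ^+ i / 2) ^+ d.-1 / (4 * i%:R) ^+ d.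

Lemma weight_bound_ge0 d i : 0 <= weight_bound d i.
Proof. by rewrite mulr_ge0 ?invr_ge0 ?exprn_ge0 ?mulr_ge0 ?exprn_ge0. Qed.

Lemma admissible_weight_ge d i (delta e : R) : (0 < i)%N ->
  delta < expR (-1) -> 0 < e < delta ->
  `[@dyadic R (i.+1 * 2 ^ i.+1), @dyadic R (i * 2 ^ i)[%classic e ->
  weight_bound d i * e^-1 <= admissible_weight d e.
Proof.
move=> i0 dE ed; have /andP[e0 _] := ed; have [L1 LL0] := lnln_gt0 dE ed.
rewrite /= in_itv /= => /andP[e1 e2].
have L2 : i%:R * 2 ^+ i / 2 <= ln e^-1.
  have : ln (2 ^+ (i * 2 ^ i)) <= ln e^-1 :> R.
    rewrite ler_ln ?posrE ?exprn_gt0 ?invr_gt0//.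
    by rewrite -[leLHS]invrK lef_pV2 ?posrE ?dyadic_gt0// ltW.
  apply: le_trans; rewrite lnXn// -(mulr_natl (ln 2)) natrM natrX.
  by rewrite ler_wpM2l ?ln2_ge// mulr_ge0// exprn_ge0.
have L3 : ln (ln e^-1) <= 4 * i%:R.
  have : ln e^-1 <= ln (2 ^+ (i.+1 * 2 ^ i.+1)) :> R.
    rewrite ler_ln ?posrE ?exprn_gt0 ?invr_gt0//.
    by rewrite -[leRHS]invrK lef_pV2 ?posrE ?dyadic_gt0.
  rewrite lnXn// -(mulr_natl (ln 2)) => L4.
  (* A cruder bound by a pure power of 2 keeps the second logarithm simple: it is at most
     [2 (i + 1)], hence at most [4 i] as [i >= 1]. *)
  have L5 : ln e^-1 <= 2 ^+ (2 * i.+1).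
    apply: le_trans L4 _; apply: (@le_trans _ _ (i.+1 * 2 ^ i.+1)%:R).
      by rewrite ler_piMr ?ln2_le1.
    rewrite -natrX ler_nat mul2n -addnn expnD leq_mul2r; apply/orP; right.
    exact/ltnW/ltn_expl.
  apply: (@le_trans _ _ (ln (2 ^+ (2 * i.+1)))).
    by rewrite ler_ln ?posrE ?exprn_gt0// (lt_trans ltr01).
  rewrite lnXn// -(mulr_natl (ln 2)); apply: (@le_trans _ _ (2 * i.+1)%:R).
    by rewrite ler_piMr ?ln2_le1.
  by rewrite -natrM ler_nat; lia.
rewrite /weight_bound /admissible_weight invfM mulrAC.
have X0 (x y z : R) : x * y * z = x * (y * z) by rewrite mulrA.
rewrite X0.
have i4 : 0 < 4 * i%:R :> R by rewrite mulr_gt0// ltr0n.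
have H0 : 0 <= i%:R * 2 ^+ i / 2 :> R by rewrite mulr_ge0 ?mulr_ge0 ?exprn_ge0.
apply: ler_pM;
  rewrite ?exprn_ge0 ?mulr_ge0 ?invr_ge0 ?exprn_ge0 ?(ltW e0) ?(ltW i4)//.
- by rewrite lerXn2r ?nnegrE// ltW// (lt_trans ltr01).
- rewrite ler_wpM2l ?invr_ge0 ?(ltW e0)//.
  rewrite lef_pV2 ?posrE ?exprn_gt0//.
  by apply: lerXn2r; rewrite ?nnegrE ?(ltW i4) ?(ltW LL0).
Qed.

(** Block [i] contains at least [i 2 ^ i] dyadic intervals. Half this number is the factor that
    raises the exponent [d - 1] to [d], after which [i] cancels. *)
Lemma weight_bound_sum d i : (0 < d)%N -> (0 < i)%N ->
  (2 ^+ i / 8) ^+ d <=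
    (i.+1 * 2 ^ i.+1 - i * 2 ^ i)%:R / 2 * weight_bound d i :> R.
Proof.
move=> d0 i0; have iR : 0 < i%:R :> R by rewrite ltr0n.
apply: (@le_trans _ _ ((i%:R * 2 ^+ i / 2) * weight_bound d i)); last first.
  rewrite ler_wpM2r ?weight_bound_ge0// ler_wpM2r ?invr_ge0//.
  rewrite -natrX -natrM ler_nat expnS.
  have : (0 < 2 ^ i)%N by rewrite expn_gt0.
  by move: (2 ^ i)%N => P; nia.
rewrite /weight_bound mulrA -exprS prednK// -expr_div_n le_eqVlt.
apply/orP; left; apply/eqP; congr (_ ^+ _).
by field; rewrite gt_eqF.
Qed.

End Growth.

(** * Summation over blocks of eigenvalues *)

Section TraceClass.
Context {R : realType}.
Local Notation mu := (@lebesgue_measure R).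

Lemma summable_of_admissible (d : nat) (f : R -> R[i]) (lam : nat -> R)
    (C a : R) :
  (0 < d)%N -> trace_class_admissible d f -> 0 <= C -> 0 <= a ->
  (forall k M, (M ^ d <= k)%N -> 0 <= lam k <= C * (a ^+ M / M`!%:R)) ->
  (\sum_(k <oo) (normc (f (lam k)))%:E < +oo)%E.
Proof.
move=> d0 [delta [delta0 dE fJ]] C0 a0 lamP.
have [i0 i0P] := superexponential_le C0 a0.
pose F e := (M0 f e * (admissible_weight d e)%:E)%E.
have {}fJ : (\int[mu]_(e in `]0%R, delta[) F e < +oo)%E by exact: fJ.
set J := (\int[mu]_(e in `]0%R, delta[) F e)%E in fJ.
have mF : measurable_fun `]0, delta[%classic F.
  apply: emeasurable_funM.
    by apply: measurable_funTS; apply: nondecreasing_emeasurable;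
      exact: M0_nondecreasing.
  by apply/measurable_EFinP; exact: measurable_admissible_weight.
have F0 e : `]0, delta[%classic e -> (0 <= F e)%E.
  rewrite /= in_itv /= => ed; have /andP[e0 _] := ed.
  have [L1 L0] := lnln_gt0 dE ed.
  apply: mule_ge0; first exact/M0_ge0/ltW.
  have L00 : 0 <= ln e^-1 by rewrite ltW// (lt_trans ltr01).
  by rewrite lee_fin divr_ge0 ?mulr_ge0 ?exprn_ge0// ltW.
pose ep i := @dyadic R (i * 2 ^ i).
have leep i j : (i <= j)%N -> ep j <= ep i.
  move=> ij; apply: le_dyadic; rewrite leq_mul// leq_pexp2l//.
(* From [i1] on the superexponential estimate holds and the blocks lie inside the domain of the
   admissibility integral. *)
have [i1 [i1i0 i1_gt0 i1d]] : exists i1,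
    [/\ (i0 <= i1)%N, (0 < i1)%N & ep i1 <= delta].
  pose n := Num.bound delta^-1.
  exists (maxn n (maxn i0 1)); split.
  - by rewrite !leq_max leqnn orbT.
  - by rewrite !leq_max orbT.
  - have dn : delta^-1 < n%:R by apply: archi_boundP; rewrite invr_ge0 ltW.
    apply: (@le_trans _ _ (ep n)); first exact/leep/leq_maxl.
    rewrite /ep /dyadic -[leRHS]invrK lef_pV2 ?posrE ?exprn_gt0 ?invr_gt0//.
    rewrite (le_trans (ltW dn))// -natrX ler_nat.
    have [->//|n0] := posnP n.
    rewrite (@leq_trans (n * 2 ^ n))// ?leq_pmulr ?expn_gt0// ltnW//.
    exact: ltn_expl.
have subd i j : (i1 <= i)%N -> `[ep j, ep i[%classic `<=` `]0, delta[%classic.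
  move=> i1i e /=; rewrite !in_itv /= => /andP[e1 e2].
  rewrite (lt_le_trans (dyadic_gt0 _) e1) (lt_le_trans e2)//.
  exact: le_trans (leep _ _ i1i) i1d.
have block i : (i1 <= i)%N ->
    (((2 ^+ i / 8) ^+ d)%:E * M0 f (ep i.+1) <=
     \int[mu]_(e in `[ep i.+1, ep i[) F e)%E.
  move=> i1i; have ii0 : (0 < i)%N by exact: leq_trans i1i.
  have M00 : (0 <= M0 f (ep i.+1))%E by apply: M0_ge0; exact/ltW/dyadic_gt0.
  have le12 : (i * 2 ^ i <= i.+1 * 2 ^ i.+1)%N by rewrite leq_mul// leq_pexp2l.
  have E : ep i.+1 = @dyadic R (i * 2 ^ i + (i.+1 * 2 ^ i.+1 - i * 2 ^ i)).
    by rewrite subnKC.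
  have := @dyadic_integral_ge R F (M0 f (ep i.+1) * (@weight_bound R d i)%:E)%E
    (i * 2 ^ i) (i.+1 * 2 ^ i.+1 - i * 2 ^ i).
  rewrite -E -/(ep i) => H; apply: le_trans (H _ _ _).
  - rewrite [(M0 _ _ * _)%E]muleC muleA -EFinM lee_wpmul2r// lee_fin.
    exact: weight_bound_sum.
  - by rewrite mule_ge0// lee_fin weight_bound_ge0.
  - apply: measurable_funS mF => //; exact: subd.
  - move=> e ei; have ed := subd _ _ i1i _ ei.
    rewrite -muleA -EFinM; apply: lee_pmul => //.
    + by rewrite lee_fin mulr_ge0 ?weight_bound_ge0// invr_ge0;
        move: ed; rewrite /= in_itv /= => /andP[/ltW].
    + by apply: M0_nondecreasing; move: ei; rewrite /= in_itv /= => /andP[].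
    + by rewrite lee_fin; apply: admissible_weight_ge dE _ ei => //;
        move: ed; rewrite /= in_itv.
have leJ i j : (i1 <= i)%N -> (\int[mu]_(e in `[ep j, ep i[) F e <= J)%E.
  by move=> i1i; apply: ge0_subset_integral => //; exact: subd.
pose g k := normc (f (lam k)).
pose T n : R := \sum_(0 <= k < n) g k.
(* This is [(2 ^ (i + 3)) ^ d]: from this index on [M = 2 ^ (i + 3)] may be used, so
   [lam k <= ep (i + 1)]. *)
pose P i := (2 ^ ((i + 3) * d))%N.
have PS i : (P i <= P i.+1)%N by rewrite leq_pexp2l// leq_mul2r addSn leqnSn orbT.
have step i : (i1 <= i)%N -> ((T (P i.+1))%:E <= (T (P i))%:E +
    (128 ^+ d)%:E * \int[mu]_(e in `[ep i.+1, ep i[) F e)%E.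
  move=> i1i; have Bi := block i i1i.
  have M00 : (0 <= M0 f (ep i.+1))%E by apply: M0_ge0; exact/ltW/dyadic_gt0.
  have K0 : 0 < (2 ^+ i / 8) ^+ d :> R by rewrite exprn_gt0// divr_gt0 ?exprn_gt0.
  (* Finiteness of [M0 f] near 0 is not assumed; it follows because a positive multiple of this
     value is at most [J]. *)
  have [r Mr] : exists r, M0 f (ep i.+1) = r%:E.
    have := le_lt_trans Bi (le_lt_trans (leJ i i.+1 i1i) fJ).
    case: (M0 f (ep i.+1)) M00 => [r _ _|_|//]; first by exists r.
    by rewrite gt0_muley ?lte_fin.
  rewrite Mr in Bi M00; rewrite lee_fin in M00.
  apply: (@le_trans _ _
    ((T (P i))%:E + (128 ^+ d * ((2 ^+ i / 8) ^+ d * r))%:E)%E).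
    rewrite -EFinD lee_fin /T (big_cat_nat _ (PS i))//= lerD2l.
    apply: (@le_trans _ _ (\sum_(P i <= k < P i.+1) r)).
      rewrite !big_nat; apply: ler_sum => k /andP[Pk _].
      rewrite -lee_fin -Mr; apply: M0_ge.
      have Mk : ((2 ^ (i.+1 + 2)) ^ d <= k)%N.
        by apply: leq_trans Pk; rewrite -expnM /P addSnnS.
      have /andP[-> /le_trans] := lamP _ _ Mk; apply; apply: i0P.
      exact: leq_trans i1i0 (leqW i1i).
    rewrite sumr_const_nat -(mulr_natl r) mulrA ler_wpM2r//.
    apply: (@le_trans _ _ (P i.+1)%:R); first by rewrite ler_nat leq_subr.
    (* Source of the constant 128: [2 ^ (i + 4)] equals [128] times [2 ^ i / 8]. *)
    rewrite -exprMn /P natrX exprM le_eqVlt; apply/orP; left; apply/eqP.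
    congr (_ ^+ _); by rewrite addSn !exprS exprD; field.
  by rewrite leeD2l// EFinM lee_wpmul2l// lee_fin exprn_ge0.
(* The one-block estimates add up because consecutive blocks are adjacent and disjoint. *)
have partial m : ((T (P (i1 + m)%N))%:E <= (T (P i1))%:E +
    (128 ^+ d)%:E * \int[mu]_(e in `[ep (i1 + m)%N, ep i1[) F e)%E.
  have k0 : (0 <= (128 ^+ d)%:E :> \bar R)%E by rewrite lee_fin exprn_ge0.
  have I0 i j : (i1 <= i)%N -> (0 <= \int[mu]_(e in `[ep j, ep i[) F e)%E.
    by move=> i1i; apply: integral_ge0 => e ei; apply: F0; exact: subd ei.
  elim: m => [|m IH]; first by rewrite addn0 leeDl// mule_ge0// I0.
  rewrite addnS; apply: le_trans (step _ (leq_addr m i1)) _.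
  apply: le_trans (leeD2r _ IH) _; rewrite -addeA leeD2l//.
  have U : `[ep (i1 + m).+1%N, ep i1[%classic =
      `[ep (i1 + m)%N, ep i1[%classic `|`
      `[ep (i1 + m).+1%N, ep (i1 + m)%N[%classic.
    by rewrite setUC -itv_bndbnd_setU// bnd_simp leep// leq_addr.
  rewrite U ge0_integral_setU//.
  - by rewrite (ge0_muleDr _ (I0 _ _ (leqnn i1)) (I0 _ _ (leq_addr m i1))).
  - by rewrite -U; apply: measurable_funS mF => //; exact: subd.
  - by rewrite -U => e ei; apply: F0; exact: subd ei.
  - rewrite disj_set2E; apply/eqP/seteqP; split => // e /=.
    rewrite !in_itv /= => -[/andP[h1 _] /andP[_ h2]].
    by move: (lt_le_trans h2 h1); rewrite ltxx.
apply: (@le_lt_trans _ _ ((T (P i1))%:E + (128 ^+ d)%:E * J)%E); last first.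
  have J0 : (0 <= J)%E by exact: integral_ge0.
  by rewrite lte_add_pinfty ?ltry// lte_mul_pinfty// lee_fin exprn_ge0.
apply: lime_le.
  by apply: is_cvg_nneseries => k _ _; rewrite lee_fin normc_ge0.
(* As [n <= P (i1 + n)], each partial sum is dominated by one ending at a block boundary, with a
   bound independent of [n]. *)
near=> n; rewrite sumEFin.
apply: (@le_trans _ _ (T (P (i1 + n)%N))%:E).
  rewrite lee_fin /T [leRHS](@big_cat_nat _ _ _ n)//=; last first.
    rewrite /P ltnW// (leq_trans (ltn_expl n (ltnSn 1)))// leq_pexp2l//.
    rewrite (@leq_trans (i1 + n + 3)%N) ?leq_pmulr//.
    by rewrite addnAC leq_addl.
  by rewrite lerDl sumr_ge0// => k _; exact: normc_ge0.
apply: le_trans (partial n) _.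
by rewrite leeD2l// lee_wpmul2l ?lee_fin ?exprn_ge0// leJ.
Unshelve. all: by end_near. Qed.

End TraceClass.

Theorem theorem1p9 (R : realType) (d : nat) (d_gt0 : (0 < d)%N)
  (A B : set (Rd R d))
  (mA : lebesgue_measurableRd A) (bA : boundedRd A)
  (mB : lebesgue_measurableRd B) (bB : boundedRd B)
  (f : R -> complex R) (f_adm : trace_class_admissible d f) :
  trace_class_fun (SS A B) f.
Proof.
have [C [a [C0 a0 lamP]]] := eigenvalue_SS_le mA bA mB bB.
exact: (summable_of_admissible d_gt0 f_adm C0 a0 lamP).
Qed.
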